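(* There exists a group homomorphism $\rho:\mathrm{SL}(2,\mathbf Z)\to\mathcal A^\times$ with the following properties. (a) The $\mathbf C\,\mathrm{SL}(2,\mathbf Z)$-module $E$ (with $Y$ acting on $E$ by left multiplication by $\rho(Y)$ in the basis $\{e_n\}$) has an ascending filtration $0=E_0\subset E_1\subset E_2\subset\cdots$ by $\mathbf C\,\mathrm{SL}(2,\mathbf Z)$-submodules such that for each $i\in\mathbf N$ the quotient $E_i/E_{i-1}$ is isomorphic to the standard $2$-dimensional $\mathbf C\,\mathrm{SL}(2,\mathbf Z)$-module. (b) $\rho(T)=D$. (c) $\rho(Y)$ is an integer matrix for every $Y\in\mathrm{SL}(2,\mathbf Z)$. (d) $\rho(\mathrm{SL}(2,\mathbf Z))\subseteq\mathcal{DR}_0$.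
   Context: $\mathbf N=\{1,2,\dots\}$. $E$ is the complex vector space with basis $\{e_n\}_{n\in\mathbf N}$; $\mathcal A$ is the ring of matrices $(a_{i,j})_{i,j\in\mathbf N}$ with complex entries such that each column has only finitely many nonzero entries (these are exactly the endomorphisms of $E$ acting on the left), and $\mathcal A^\times$ its group of units. $T=\begin{pmatrix}1&1\\0&1\end{pmatrix}\in\mathrm{SL}(2,\mathbf Z)$. The divisor matrix is $D=(d_{i,j})_{i,j\in\mathbf N}$ with $d_{i,j}=1$ if $i$ divides $j$ and $d_{i,j}=0$ otherwise. $\mathcal{DR}_0$ denotes the set of matrices $A=(a_{i,j})\in\mathcal A$ for which there exist positive constants $C,c$ (depending on $A$) such that $a_{i,j}=0$ whenever $i>Cj^c$ and $|a_{i,j}|\le Cj^c$ for all $i,j$. *)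

(* Defs.v *)
From HB Require Import structures.
From mathcomp Require Import all_boot all_order all_algebra.
From mathcomp Require Import complex.
From mathcomp Require Import reals Rstruct exp.
Set Implicit Arguments. Unset Strict Implicit. Unset Printing Implicit Defensive.
Import Order.TTheory GRing.Theory Num.Theory.
Local Open Scope ring_scope.

Definition RR : realType := Rdefinitions.R.
Definition CC : numClosedFieldType := RR[i].

(* Infinite matrices (a_{i,j})_{i,j in N}, N = {1,2,...}.
   Convention: index k : nat stands for k+1 in N, so A i j = a_{i+1,j+1}. *)
Definition infmx := nat -> nat -> CC.
(* Vectors of E with coordinates in the basis (e_n): v k = coordinate on e_{k+1}. *)
Definition vec := nat -> CC.

Definition finsupp (v : vec) : Prop := exists N, forall k, (N <= k)%N -> v k = 0.

Definition colfin (A : infmx) : Prop :=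
  forall j, exists N, forall i, (N <= i)%N -> A i j = 0.

(* C = A * B (matrix product, well defined when B is column finite):
   the (i,j) entry is sum_k A i k * B k j, the sum being finite. *)
Definition mxmul_eq (A B C : infmx) : Prop :=
  forall i j N, (forall k, (N <= k)%N -> B k j = 0) ->
    C i j = \sum_(k < N) A i k * B k j.

Definition idmx : infmx := fun i j => if i == j then 1 else 0.

Definition is_unit_mx (A : infmx) : Prop :=
  colfin A /\ exists B, colfin B /\ mxmul_eq A B idmx /\ mxmul_eq B A idmx.

Definition act_eq (A : infmx) (v w : vec) : Prop :=
  forall i N, (forall k, (N <= k)%N -> v k = 0) ->
    w i = \sum_(k < N) A i k * v k.

Definition inSL2Z (X : 'M[int]_2) : Prop := \det X = 1.

Definition Tmx : 'M[int]_2 := \matrix_(i < 2, j < 2) (if (i <= j)%N then 1 else 0).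

Definition divisor_mx : infmx := fun i j => if (i.+1 %| j.+1)%N then 1 else 0.

(* The class DR_0. Indices i,j are 1-based in the definition, hence i.+1, j.+1. *)
Definition DR0 (A : infmx) : Prop :=
  colfin A /\
  exists (K c : RR), 0 < K /\ 0 < c /\
    forall i j : nat,
      ((i.+1)%:R > K * (j.+1)%:R `^ c -> A i j = 0) /\
      ComplexField.Normc.normc (A i j) <= K * (j.+1)%:R `^ c.

Definition subspaceE (S : vec -> Prop) : Prop :=
  (forall v, S v -> finsupp v) /\
  S (fun _ => 0) /\
  (forall (a : CC) v w, S v -> S w -> S (fun k => a * v k + w k)).

Definition submoduleE (rho : 'M[int]_2 -> infmx) (S : vec -> Prop) : Prop :=
  subspaceE S /\
  forall Y, inSL2Z Y -> forall v w, S v -> act_eq (rho Y) v w -> S w.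

(* The quotient S / S' (S' a submodule contained in S) is isomorphic to the
   standard 2-dimensional module C^2 (column vectors, Y acting by the matrix Y):
   there is a surjective C-linear module map phi : S -> C^2 with kernel S'. *)
Definition quot_iso_std (rho : 'M[int]_2 -> infmx) (S S' : vec -> Prop) : Prop :=
  exists phi : vec -> 'cV[CC]_2,
    (forall (a : CC) v w, S v -> S w ->
        phi (fun k => a * v k + w k) = a *: phi v + phi w) /\
    (forall x : 'cV[CC]_2, exists v, S v /\ phi v = x) /\
    (forall v, S v -> (phi v = 0 <-> S' v)) /\
    (forall Y, inSL2Z Y -> forall v w, S v -> act_eq (rho Y) v w ->
        phi w = map_mx (fun z : int => z%:~R) Y *m phi v).

(* Main.v *)
Require Import Defs.
From HB Require Import structures.
From mathcomp Require Import all_boot all_order all_algebra.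
From mathcomp Require Import complex.
From mathcomp Require Import boolp.
From mathcomp Require Import reals Rstruct exp.
From mathcomp Require Import zify ring lra.
Set Implicit Arguments. Unset Strict Implicit. Unset Printing Implicit Defensive.
Import Order.TTheory GRing.Theory Num.Theory.
Local Open Scope ring_scope.

(** Let [H] be the operator on [E] with [H e_(2n) = e_n] and [H e_n = 0] for odd [n].  The
    matrices [S' = (0 -1; 1 0)] and [T' = (x^2-x+1 1-x; -x 1)] over [Z[x]] satisfy the
    relations of [SL(2,Z)] and specialize to [S] and [T] at [x = 0].  With [x] acting as [H],
    they make [E + E] a module which the supports in [{1..n}] filter with standard quotients,
    because [H] strictly lowers indices.

    Both [N' = T' - 1] on [E + E] and [N = D - 1] on [E] are locally nilpotent, and a vector
    killed by [N] (or by [N']) is determined by its coordinates of odd index (those of its first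
    component, for [N']).  Right inverses of [N] and [N'] which create no coordinates of odd
    index therefore yield, by recursion on the basis, mutually inverse isomorphisms [psi]
    from [E] to [E + E] and [phi] back which exchange [N] and [N'].  Transporting the action
    along them turns [T'] into [D].

    All these recursions have integer coefficients.  For the growth condition, consider the
    weighted norm [sum_i |a_i| i^c]: the sum of [d^c] over the proper divisors [d] of [n] is
    small compared to [n^c] for large [c], so each recursion maps one weighted norm boundedly
    into another.  For an integral matrix such bounds also control the support of the columns.

    [E] is represented by polynomials, [e_n] by ['X^(n-1)].  So [H] is [odd_poly], and
    [even_poly] reads off the coordinates of odd index. *)

(** * Words in the generators of SL(2,Z) *)

Definition mx2 (R : nzRingType) (a b c d : R) : 'M[R]_2 :=
  \matrix_(i, j) if i == 0 then if j == 0 then a else b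
                 else if j == 0 then c else d.

Lemma mx2P (R : nzRingType) (Y : 'M[R]_2) :
  Y = mx2 (Y 0 0) (Y 0 1) (Y 1 0) (Y 1 1).
Proof.
apply/matrixP => i j; rewrite mxE.
by case: (unliftP 0 i) => [i'|] ->; case: (unliftP 0 j) => [j'|] -> //=;
  rewrite ?ord1 //=; congr (Y _ _); apply: val_inj.
Qed.

Lemma mx2_mul (R : nzRingType) (a b c d a' b' c' d' : R) :
  mx2 a b c d *m mx2 a' b' c' d' =
  mx2 (a * a' + b * c') (a * b' + b * d') (c * a' + d * c') (c * b' + d * d').
Proof.
by rewrite [LHS]mx2P !mxE !big_ord_recl !big_ord0 !mxE /= !addr0.
Qed.

Lemma det_mx2 (R : comNzRingType) (a b c d : R) :
  \det (mx2 a b c d) = a * d - b * c.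
Proof.
rewrite (expand_det_row _ 0) !big_ord_recl big_ord0 /cofactor !det_mx11 !mxE /=.
by rewrite /bump /= !expr1 expr0; ring.
Qed.

Definition iterz (V : Type) (t t' : V -> V) (n : int) (v : V) : V :=
  match n with Posz k => iter k t v | Negz k => iter k.+1 t' v end.

Lemma iterzS (V : Type) (t t' : V -> V) (n : int) (v : V) :
  cancel t' t -> iterz t t' (n + 1) v = t (iterz t t' n v).
Proof.
move=> t'K; case: n => [k|[|k]].
- by rewrite (_ : Posz k + 1 = Posz k.+1) //; lia.
- by rewrite /= t'K.
- by rewrite (_ : Negz k.+1 + 1 = Negz k) /= ?t'K //; lia.
Qed.

(* The Euclidean algorithm on the first column of the matrix with rows [a b], [c d];
   with a*c/(c*c) as quotient, the remainder [a - n*c] has the sign of [c]. *)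
Fixpoint euclid_act (V : Type) (s t t' : V -> V) (k : nat) (a b c d : int) (v : V) : V :=
  if k is k'.+1 then
    if c == 0 then
      if 0 < a then iterz t t' b v else s (s (iterz t t' (- b) v))
    else
      let n := ((a * c) %/ (c * c))%Z in
      iterz t t' n (s (s (s (euclid_act s t t' k' (- c) (- d) (a - n * c) (b - n * d) v))))
  else v.

(** The word spells [Y = T^n S^3 (S T^-n Y)], where [S^3] inverts [S]. The fuel suffices because the
    lower left entry drops in absolute value at each division. *)
Definition sl2act (V : Type) (s t t' : V -> V) (a b c d : int) (v : V) : V :=
  euclid_act s t t' `|c|.+1 a b c d v.

Lemma euclid_rem (a c : int) : c != 0 ->
  let r := a - ((a * c) %/ (c * c))%Z * c in 0 <= r * c < c * c.
Proof.
move=> c0 /=; have cc : 0 < c * c by rewrite -expr2 exprn_even_gt0.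
have := divz_eq (a * c) (c * c); have := ltz_pmod (a * c) cc.
have := modz_ge0 (a * c) (lt0r_neq0 cc).
set q := (_ %/ _)%Z; set r := (_ %% _)%Z => r0 r1 e.
have -> : (a - q * c) * c = r by rewrite -[r](addKr (q * (c * c))) -e; ring.
by rewrite r0.
Qed.

Lemma euclid_rem_lt (a c : int) : 0 <= a * c < c * c -> (`|a| < `|c|)%N.
Proof. by move=> /andP[h1 h2]; nia. Qed.

Lemma euclid_act_fuel (V : Type) (s t t' : V -> V) (k : nat) (a b c d : int) (v : V) :
  (`|c| < k)%N -> euclid_act s t t' k a b c d v = sl2act s t t' a b c d v.
Proof.
suff gen l : (`|c| < k)%N -> (`|c| < l)%N ->
    euclid_act s t t' k a b c d v = euclid_act s t t' l a b c d v.
  by move=> ck; apply: gen.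
elim: k l a b c d => [|k IH] [|l] a b c d //= ck cl.
case: eqP => // /eqP c0; congr (iterz _ _ _ (s (s (s _)))).
by apply: IH; have /euclid_rem_lt := euclid_rem a c0; lia.
Qed.

Lemma sl2act_c0 (V : Type) (s t t' : V -> V) (a b d : int) (v : V) :
  sl2act s t t' a b 0 d v =
  if 0 < a then iterz t t' b v else s (s (iterz t t' (- b) v)).
Proof. by []. Qed.

Lemma sl2act_rec (V : Type) (s t t' : V -> V) (a b c d : int) (v : V) : c != 0 ->
  let n := ((a * c) %/ (c * c))%Z in
  sl2act s t t' a b c d v =
  iterz t t' n (s (s (s (sl2act s t t' (- c) (- d) (a - n * c) (b - n * d) v)))).
Proof.
move=> c0 /=; rewrite {1}/sl2act /= (negbTE c0); congr (iterz _ _ _ (s (s (s _)))).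
by apply: euclid_act_fuel; have /euclid_rem_lt := euclid_rem a c0; lia.
Qed.

Lemma mulz_eq1 (a d : int) : a * d = 1 -> (a = 1 /\ d = 1) \/ (a = - 1 /\ d = - 1).
Proof.
move=> ad; have := intUnitRing.unitzPl ad; rewrite qualifE /=.
by move=> /orP [/eqP d1|/eqP d1]; rewrite d1 in ad *; [left|right]; split=> //; lia.
Qed.

(** * Equivariance of the Euclidean words under S and T *)

Section Relations.
Variables (V : Type) (s t t' : V -> V).
Hypotheses (tK : cancel t t') (t'K : cancel t' t).
Hypothesis s4 : forall v, s (s (s (s v))) = v.
Hypothesis st3 : forall v, s (t (s (t (s (t v))))) = s (s v).
Notation F := (sl2act s t t').

(** By [st3], [s s] is a power of [s t] and so commutes with it; cancelling [s] leaves [t]. *)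
Lemma sst v : s (s (t v)) = t (s (s v)).
Proof.
have st6 w : s (t (s (s w))) = s (s (s (t w))) by rewrite -!st3.
by rewrite -[RHS]s4 st6 s4.
Qed.

Lemma ss_iterz n v : s (s (iterz t t' n v)) = iterz t t' n (s (s v)).
Proof.
have sst' w : s (s (t' w)) = t' (s (s w)) by rewrite -[LHS]tK -sst t'K.
case: n => k; rewrite /iterz; first by elim: k => //= k <-; rewrite sst.
by elim: k.+1 => //= l <-.
Qed.

(** Adding [c] to [a] raises the quotient by one and keeps the remainder, hence the recursive
    call. *)
Lemma sl2act_T a b c d v : a * d - b * c = 1 ->
  F (a + c) (b + d) c d v = t (F a b c d v).
Proof.
have [->|c0] := eqVneq c 0 => dt.
  rewrite mulr0 subr0 in dt; rewrite addr0 !sl2act_c0.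
  have [[-> ->]|[-> ->]] := mulz_eq1 dt; first by rewrite iterzS.
  by rewrite /= -sst -iterzS //; congr (s (s (iterz _ _ _ _))); lia.
rewrite (sl2act_rec _ _ _ (a + c)) // (sl2act_rec _ _ _ a) // -iterzS //.
rewrite mulrDl divzDr ?dvdzz // divzz mulf_eq0 (negbTE c0) /=.
congr (iterz _ _ _ (s (s (s (F _ _ _ _ _))))); ring.
Qed.

(** Only [a * c] and [c * c] enter the quotient, so negating the matrix keeps it; [s s] passes
    through the powers of [t] to the recursive call. *)
Lemma sl2act_N a b c d v : a * d - b * c = 1 ->
  F (- a) (- b) (- c) (- d) v = s (s (F a b c d v)).
Proof.
move: {2}(`|c|.+1) (ltnSn `|c|) => k; elim: k a b c d v => // k IH a b c d v ck dt.
have [c0|c0] := eqVneq c 0.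
  rewrite c0 mulr0 subr0 in dt; rewrite c0 oppr0 !sl2act_c0 opprK.
  by have [[-> _]|[-> _]] := mulz_eq1 dt; rewrite //= s4.
rewrite (sl2act_rec _ _ _ (- a)) ?oppr_eq0 // (sl2act_rec _ _ _ a) // !mulrNN.
rewrite ss_iterz; congr iterz; do 3 congr s.
have /euclid_rem_lt := euclid_rem a c0; set n := (_ %/ _)%Z => rc.
rewrite -IH; first by congr F; ring.
  by lia.
by rewrite -dt; ring.
Qed.

(** The quotient is 0, so the recursion reads [F Y = s^3 (F (S Y))]. *)
Lemma sl2act_S_direct a b c d v : a * d - b * c = 1 -> 0 <= a * c < c * c ->
  F (- c) (- d) a b v = s (F a b c d v).
Proof.
move=> dt h; have c0 : c != 0 by apply/eqP => c0; rewrite c0 in h; lia.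
have n0 : ((a * c) %/ (c * c))%Z = 0 by apply: divz_small; lia.
by rewrite (sl2act_rec _ _ _ a) //= n0 !mul0r !subr0 /= s4.
Qed.

Lemma sl2act_S_c0 a b d v : a * d = 1 ->
  F 0 (- d) a b v = s (F a b 0 d v).
Proof.
move=> dt; have h : F (- a) (- b) 0 (- d) v = s (F 0 (- d) a b v).
  by apply: sl2act_S_direct; [rewrite -dt; ring|nia].
have N : F (- a) (- b) (- 0) (- d) v = s (s (F a b 0 d v)).
  by apply: sl2act_N; rewrite -dt; ring.
by rewrite -[LHS]s4 -h -[X in F _ _ X]oppr0 N s4.
Qed.

(** Since [S^2 = -1], the claim for [S Y] gives the claim for [Y]; this exchanges the roles of [a]
    and [c] up to sign. *)
Lemma sl2act_S_sym a b c d v : a * d - b * c = 1 ->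
  F (- a) (- b) (- c) (- d) v = s (F (- c) (- d) a b v) ->
  F (- c) (- d) a b v = s (F a b c d v).
Proof. by move=> dt h; rewrite -[LHS]s4 -h sl2act_N // s4. Qed.

Lemma sl2act_S_far a b c d v : a * d - b * c = 1 -> a * c < - (c * c) ->
  F (- c) (- d) a b v = s (F a b c d v).
Proof.
move=> dt h; apply: sl2act_S_sym => //; apply: sl2act_S_direct; first by rewrite -dt; ring.
by nia.
Qed.

(** Here [S] is spelled [T S T S T], a form of [st3]. The first [S] to act meets a matrix with
    quotient 0. The second meets one with the smaller lower left entry [a + c], covered by the cases
    above or by induction. *)
Lemma sl2act_S_neg a b c d v : a * d - b * c = 1 -> - (c * c) <= a * c < 0 ->
  F (- c) (- d) a b v = s (F a b c d v).
Proof.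
move: {2}(`|c|.+1) (ltnSn `|c|) => k; elim: k a b c d v => // k IH a b c d v ck dt h.
have dt1 : (a + c) * d - (b + d) * c = 1 by rewrite -dt; ring.
have dt2 : - c * (b + d) - - d * (a + c) = 1 by rewrite -dt; ring.
have dt3 : a * (b + d) - b * (a + c) = 1 by rewrite -dt; ring.
have dt4 : - (a + c) * b - - (b + d) * a = 1 by rewrite -dt; ring.
have E2 : F a b (a + c) (b + d) v = t (s (t (F a b c d v))).
  rewrite -(sl2act_T v dt) -sl2act_S_direct //; last by nia.
  by rewrite -(sl2act_T v dt2); congr F; ring.
have E3 : F (- (a + c)) (- (b + d)) a b v = s (F a b (a + c) (b + d) v).
  have [ac|ac] := eqVneq (a + c) 0.
    by rewrite ac oppr0 sl2act_S_c0 //; move: dt3; rewrite ac; lia.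
  have [h1|h1] := boolP (a * (a + c) < - ((a + c) * (a + c))).
    exact: sl2act_S_far.
  by apply: IH => //; nia.
transitivity (t (F (- (a + c)) (- (b + d)) a b v)).
  by rewrite -sl2act_T //; congr F; ring.
rewrite E3 E2.
by rewrite -[LHS]s4 st3 s4.
Qed.

Lemma sl2act_S a b c d v : a * d - b * c = 1 ->
  F (- c) (- d) a b v = s (F a b c d v).
Proof.
move=> dt; have [c0|c0] := eqVneq c 0.
  by rewrite c0 oppr0 sl2act_S_c0 //; rewrite c0 in dt; lia.
have [h1|h1] := boolP (a * c < - (c * c)); first exact: sl2act_S_far.
have [h2|h2] := boolP (a * c < 0); first by apply: sl2act_S_neg => //; lia.
have [h3|h3] := boolP (a * c < c * c); first by apply: sl2act_S_direct => //; lia.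
(* Now [a * c >= c * c], so [S Y], with first column [(- c, a)], is in the range of
   [sl2act_S_neg]. *)
apply: sl2act_S_sym => //; apply: sl2act_S_neg; first by rewrite -dt; ring.
by nia.
Qed.
End Relations.

(** * Generation of SL(2,Z) by S, T and the inverse of T *)

Lemma mx2_1 (R : nzRingType) : mx2 1 0 0 1 = 1%:M :> 'M[R]_2.
Proof. by rewrite [RHS]mx2P !mxE. Qed.

Definition S2 : 'M[int]_2 := mx2 0 (- 1) 1 0.
Definition T2 : 'M[int]_2 := mx2 1 1 0 1.
Definition T2V : 'M[int]_2 := mx2 1 (- 1) 0 1.

Lemma S2_mul (a b c d : int) : S2 *m mx2 a b c d = mx2 (- c) (- d) a b.
Proof. by rewrite mx2_mul !mul0r !mul1r !mulN1r !add0r !addr0. Qed.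

Lemma T2_mul (a b c d : int) : T2 *m mx2 a b c d = mx2 (a + c) (b + d) c d.
Proof. by rewrite mx2_mul !mul0r !mul1r !add0r. Qed.

Lemma T2V_mul (a b c d : int) : T2V *m mx2 a b c d = mx2 (a - c) (b - d) c d.
Proof. by rewrite mx2_mul !mul0r !mul1r !mulN1r !add0r. Qed.

(** The division of [euclid_act] again: [S T^-n Y] is reached by induction on the lower left entry,
    three more factors [S] undo its [S], and [PTn] restores [T^n]. *)
Lemma SL2Z_ind (P : 'M[int]_2 -> Prop) :
  P 1%:M ->
  (forall Y, \det Y = 1 -> P Y -> P (S2 *m Y)) ->
  (forall Y, \det Y = 1 -> P Y -> P (T2 *m Y)) ->
  (forall Y, \det Y = 1 -> P Y -> P (T2V *m Y)) ->
  forall Y, \det Y = 1 -> P Y.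
Proof.
move=> P1 PS PT PTV.
have PSc a b c d : a * d - b * c = 1 -> P (mx2 a b c d) -> P (mx2 (- c) (- d) a b).
  by move=> dt; rewrite -S2_mul; apply: PS; rewrite det_mx2.
have PTn n a b c d : a * d - b * c = 1 ->
    P (mx2 a b c d) -> P (mx2 (a + n * c) (b + n * d) c d).
  move=> dt PY; case: n => k; elim: k => [|k IH].
  - by rewrite !mul0r !addr0.
  - rewrite (_ : mx2 _ _ _ _ = T2 *m mx2 (a + k%:Z * c) (b + k%:Z * d) c d).
      by apply: PT => //; rewrite det_mx2 -dt; ring.
    by rewrite T2_mul intS; congr mx2; ring.
  - rewrite (_ : mx2 _ _ _ _ = T2V *m mx2 a b c d); last first.
      by rewrite T2V_mul; congr mx2; ring.
    by apply: PTV; rewrite ?det_mx2.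
  - rewrite (_ : mx2 _ _ _ _ = T2V *m mx2 (a + (Negz k) * c) (b + (Negz k) * d) c d).
      by apply: PTV => //; rewrite det_mx2 -dt; ring.
    by rewrite T2V_mul !NegzE [Posz k.+2]intS; congr mx2; ring.
move=> Y; rewrite [Y]mx2P det_mx2; move: (Y 0 0) (Y 0 1) (Y 1 0) (Y 1 1) => a b c d.
move: {2}(`|c|.+1) (ltnSn `|c|) => k; elim: k a b c d => // k IH a b c d ck dt.
have [c0|c0] := eqVneq c 0.
  rewrite c0 mulr0 subr0 in dt *.
  have Q n : P (mx2 1 n 0 1).
    rewrite (_ : mx2 _ _ _ _ = mx2 (1 + n * 0) (0 + n * 1) 0 1); last by congr mx2; ring.
    by apply: PTn; rewrite ?mx2_1 //; ring.
  have [[-> ->]|[-> ->]] := mulz_eq1 dt; first exact: Q.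
  (* For diagonal entries -1 the matrix is [S^2 T^-b]. *)
  rewrite (_ : mx2 _ _ _ _ = mx2 (- 1) (- - b) (- 0) (- 1)); last by congr mx2; ring.
  by apply: (PSc); [ring|apply: (PSc); [ring|exact: Q]].
have /euclid_rem_lt := euclid_rem a c0; set n := (_ %/ _)%Z => rc.
have -> : mx2 a b c d = mx2 (a - n * c + n * c) (b - n * d + n * d) c d.
  by rewrite !subrK.
apply: PTn; first by rewrite -dt; ring.
have dt' : (- c) * (b - n * d) - (- d) * (a - n * c) = 1 by rewrite -dt; ring.
have PY := IH (- c) (- d) (a - n * c) (b - n * d) ltac:(lia) dt'.
have {}PY := PSc _ _ _ _ dt' PY.
have dtN : - (a - n * c) * (- d) - - (b - n * d) * (- c) = 1 by rewrite -dt; ring.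
have {}PY := PSc _ _ _ _ dtN PY.
rewrite !opprK in PY; rewrite -[a - _]opprK -[b - _]opprK; apply: PSc => //.
by rewrite -dt; ring.
Qed.

Lemma SL2Z_action (V : Type) (s t t' : V -> V) :
  cancel t t' -> cancel t' t ->
  (forall v, s (s (s (s v))) = v) ->
  (forall v, s (t (s (t (s (t v))))) = s (s v)) ->
  exists f : 'M[int]_2 -> V -> V,
    [/\ forall v, f 1%:M v = v,
        forall Y v, \det Y = 1 -> f (S2 *m Y) v = s (f Y v),
        forall Y v, \det Y = 1 -> f (T2 *m Y) v = t (f Y v)
      & forall Y v, \det Y = 1 -> f (T2V *m Y) v = t' (f Y v)].
Proof.
move=> tK t'K s4 st3.
pose f (Y : 'M[int]_2) := sl2act s t t' (Y 0 0) (Y 0 1) (Y 1 0) (Y 1 1).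
have fE a b c d v : f (mx2 a b c d) v = sl2act s t t' a b c d v.
  by rewrite /f !mxE.
have fT Y v : \det Y = 1 -> f (T2 *m Y) v = t (f Y v).
  rewrite [Y]mx2P T2_mul det_mx2 !fE; exact: sl2act_T.
exists f; split=> //.
- by move=> v; rewrite -mx2_1 fE.
- by move=> Y v; rewrite [Y]mx2P S2_mul det_mx2 !fE => dt; apply: sl2act_S.
- move=> Y v dt; rewrite -[LHS]tK -fT; last by rewrite det_mulmx dt det_mx2; ring.
  congr (t' (f _ v)); rewrite [Y]mx2P T2V_mul T2_mul; congr mx2; ring.
Qed.

(** * The intertwining isomorphisms *)

Section LinearExtension.
Variables (R : comNzRingType) (W : lmodType R).
Implicit Types (b : nat -> W) (p q : {poly R}).

Definition lext b p : W := \sum_(i < size p) p`_i *: b i.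

Lemma lextE b n p : (size p <= n)%N -> lext b p = \sum_(i < n) p`_i *: b i.
Proof.
move=> pn; rewrite /lext (big_ord_widen n (fun i => p`_i *: b i) pn) big_mkcond.
apply: eq_bigr => i _; case: ltnP => // /(nth_default 0) ->.
by rewrite scale0r.
Qed.

Lemma lext_is_linear b : linear (lext b).
Proof.
move=> a p q; set n := maxn (size p) (size q).
have pn : (size p <= n)%N by exact: leq_maxl.
have qn : (size q <= n)%N by exact: leq_maxr.
have apqn : (size (a *: p + q)%R <= n)%N.
  by rewrite (leq_trans (size_polyD _ _)) // geq_max qn (leq_trans (size_scale_leq _ _)).
rewrite !(@lextE b n) // scaler_sumr -big_split /=; apply: eq_bigr => i _.
by rewrite coefD coefZ scalerDl scalerA.
Qed.

HB.instance Definition _ b :=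
  GRing.isLinear.Build R {poly R} W *:%R (lext b) (lext_is_linear b).

Lemma lextD b p q : lext b (p + q) = lext b p + lext b q.
Proof. exact: linearD. Qed.

Lemma lextN b p : lext b (- p) = - lext b p.
Proof. exact: linearN. Qed.

Lemma lextZ b a p : lext b (a *: p) = a *: lext b p.
Proof. exact: linearZ. Qed.

Definition lextL := (lextD, lextN, lextZ).

Lemma lextXn b j : lext b 'X^j = b j.
Proof.
rewrite (@lextE _ j.+1) ?size_polyXn // big_ord_recr /= coefXn eqxx scale1r.
rewrite big1 ?add0r // => i _; rewrite coefXn ltn_eqF ?scale0r //.
Qed.

Lemma lext_poly b n (E : nat -> R) : lext b (\poly_(i < n) E i) = \sum_(i < n) E i *: b i.
Proof.
rewrite (lextE _ (size_poly _ _)); apply: eq_bigr => i _.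
by rewrite coef_poly ltn_ord.
Qed.
End LinearExtension.

Lemma poly_lin_ind (R : comNzRingType) (Q : {poly R} -> Prop) :
  (forall a p q, Q p -> Q q -> Q (a *: p + q)) -> (forall j, Q 'X^j) -> forall p, Q p.
Proof.
move=> Qlin QX p.
have Q0 : Q 0 by have := Qlin (- 1) 1 1 (QX 0%N) (QX 0%N); rewrite scaleN1r addNr.
rewrite -[p]coefK poly_def; elim: (size p) => [|n IH]; first by rewrite big_ord0.
by rewrite big_ord_recr /= addrC; apply: Qlin.
Qed.

Lemma linear_lextE (R : comNzRingType) (V : lmodType R) (g : {poly R} -> V) n (p : {poly R}) :
  linear g -> (size p <= n)%N -> g p = \sum_(k < n) p`_k *: g 'X^k.
Proof.
move=> glin pn; rewrite -(lextE (fun k => g 'X^k) pn).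
elim/poly_lin_ind: p {pn} => [a p q IHp IHq|j]; last by rewrite lextXn.
by rewrite glin lextD lextZ IHp IHq.
Qed.

Lemma coef_lext (R : comNzRingType) (b : nat -> {poly R}) (p : {poly R}) i :
  (lext b p)`_i = \sum_(j < size p) p`_j * (b j)`_i.
Proof. by rewrite coef_sum; apply: eq_bigr => j _; rewrite coefZ. Qed.

Lemma size_polyD_leq (R : nzRingType) (p q : {poly R}) n :
  (size p <= n)%N -> (size q <= n)%N -> (size (p + q)%R <= n)%N.
Proof. by move=> pn qn; rewrite (leq_trans (size_polyD p q)) // geq_max pn. Qed.

(** * Recursion on all earlier basis vectors *)

Section CourseOfValues.
Variables (W : Type) (w0 : W) (F : nat -> (nat -> W) -> W).

(** The fuel only makes the recursion structural: when [F n] looks at values below [n] alone, the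
    default [w0] does not influence [course]. *)
Fixpoint course_fuel k n := if k is k'.+1 then F n (course_fuel k') else w0.
Definition course n := course_fuel n.+1 n.

Lemma courseE n :
  (forall m g h, (forall i, (i < m)%N -> g i = h i) -> F m g = F m h) ->
  course n = F n course.
Proof.
move=> Fext; rewrite /course /=; apply: (Fext).
suff gen k l i : (i < k)%N -> (i < l)%N -> course_fuel k i = course_fuel l i.
  by move=> i ni; apply: (gen n i.+1).
elim: k l i => [|k IH] [|l] i //= ik il; apply: (Fext) => m mi.
by apply: IH; exact: leq_trans mi _.
Qed.
End CourseOfValues.

(** * The operators N and N', and the intertwiner phi *)

Section Operators.
Variable R : comNzRingType.
Local Notation P := {poly R}.
Implicit Types (p q e : P) (w : P * P).

Definition divisor_basis (j : nat) : P := \poly_(i < j.+1) (i.+1 %| j.+1)%:R.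
Definition divisor_op : P -> P := lext divisor_basis.
HB.instance Definition _ := GRing.Linear.on divisor_op.

Definition ndiv_basis (j : nat) : P := \poly_(i < j) (i.+1 %| j.+1)%:R.
Definition ndiv : P -> P := lext ndiv_basis.
HB.instance Definition _ := GRing.Linear.on ndiv.

Lemma ndivXn j : ndiv 'X^j = ndiv_basis j.
Proof. exact: lextXn. Qed.

Lemma divisor_opE p : divisor_op p = p + ndiv p.
Proof.
elim/poly_lin_ind: p => [a p q IHp IHq|j].
  by rewrite !linearP /= IHp IHq scalerDr addrACA.
rewrite ndivXn /divisor_op lextXn; apply/polyP => i; rewrite coefD coefXn !coef_poly.
rewrite ltnS leq_eqVlt; case: eqP => [->|_] /=; last by rewrite add0r.
by rewrite ltnn addr0 dvdnn.
Qed.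

Lemma size_ndiv p : (size (ndiv p) <= (size p).-1)%N.
Proof.
apply/leq_sizeP => i pi; rewrite coef_lext big1 // => j _.
have ji : (j <= i)%N by rewrite (leq_trans _ pi) // -ltnS (leq_trans (ltn_ord j)) ?leqSpred.
by rewrite coef_poly ltnNge ji mulr0.
Qed.

(* The leading index of [p] is even (1-based); [ndiv p] is nonzero at half of it. *)
Lemma ndiv_inj p : even_poly p = 0 -> ndiv p = 0 -> p = 0.
Proof.
move=> ep np; apply/eqP; apply: contraT => p0.
have sp : (0 < size p)%N by rewrite size_poly_gt0.
have lc : p`_(size p).-1 != 0 by rewrite -lead_coefE lead_coef_eq0.
have os : odd (size p).-1.
  apply: contraNT lc => os; have /(congr1 (fun e => e`_(size p).-1./2)) := ep.
  by rewrite coef_even_poly coef0 even_halfK // => ->.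
set i := (size p).-1./2; have si : size p = i.*2.+2.
  by rewrite -(prednK sp) -{1}(odd_double_half (size p).-1) os.
have /(congr1 (fun e => e`_i)) := np.
rewrite coef0 coef_lext si big_ord_recr big1 /= => [|j _].
  rewrite add0r coef_poly -addnn ltnS leq_addr addnn.
  have -> : (i.+1 %| i.*2.+2)%N by rewrite -doubleS -muln2 dvdn_mulr.
  rewrite mulr1 => pz.
  by rewrite si /= pz eqxx in lc.
rewrite coef_poly; case: ltnP => ij; last by rewrite mulr0.
suff /negbTE -> : ~~ (i.+1 %| j.+1)%N by rewrite mulr0.
have jlt := ltn_ord j; apply/negP => /dvdnP [[|[|k]] kE]; nia.
Qed.
(** In 1-based indices, the proper divisors of [2n] are [n] and some numbers below [n]. So [N e_2n]
    is [e_n] plus vectors with known preimages, and subtracting these leaves a preimage of [e_n]. *)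
Definition minv_basis : nat -> P :=
  course 0 (fun n g => 'X^(n.*2.+1) - \sum_(i < n) (i.+1 %| n.*2.+2)%:R *: g i).
Definition minv : P -> P := lext minv_basis.
HB.instance Definition _ := GRing.Linear.on minv.

Lemma minvXn j : minv 'X^j = minv_basis j.
Proof. exact: lextXn. Qed.

Lemma minv_basisE n :
  minv_basis n = 'X^(n.*2.+1) - \sum_(i < n) (i.+1 %| n.*2.+2)%:R *: minv_basis i.
Proof.
rewrite {1}/minv_basis courseE // => m g h gh; congr (_ - _).
by apply: eq_bigr => i _; rewrite gh.
Qed.

Lemma ndiv_minv p : ndiv (minv p) = p.
Proof.
elim/poly_lin_ind: p => [a p q IHp IHq|n]; first by rewrite !linearP /= IHp IHq.
rewrite minvXn; elim/ltn_ind: n => n IH.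
rewrite minv_basisE linearB (linear_sum ndiv) /= ndivXn.
rewrite (eq_bigr (fun i : 'I_n => (i.+1 %| n.*2.+2)%:R *: 'X^i)); last first.
  by move=> i _; rewrite linearZ /= IH.
rewrite -(poly_def n (fun i => (i.+1 %| n.*2.+2)%:R)); apply/polyP => k.
rewrite coefB coefXn !coef_poly; case: (ltngtP k n) => kn.
- by rewrite (leq_trans kn) ?subrr // -addnn; lia.
- rewrite subr0; case: ltnP => // kl; suff /negbTE -> : ~~ (k.+1 %| n.*2.+2)%N by [].
  by apply/negP => /dvdnP [[|[|l]] lE]; nia.
- by rewrite kn subr0 ltnS -addnn leq_addr addnn -doubleS -muln2 dvdn_mulr.
Qed.

Lemma even_polyXn j : even_poly 'X^j = if odd j then 0 else 'X^(j./2) :> P.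
Proof.
apply/polyP => i; rewrite coef_even_poly coefXn; case: ifP => oj.
  by rewrite coef0; case: eqP => // ij; rewrite -ij odd_double in oj.
by rewrite coefXn -{1}(even_halfK (negbT oj)) (inj_eq double_inj).
Qed.

Lemma odd_polyXn j : odd_poly 'X^j = if odd j then 'X^(j./2) else 0 :> P.
Proof.
apply/polyP => i; rewrite coef_odd_poly coefXn; case: ifP => oj.
  by rewrite coefXn -{1}(odd_double_half j) oj add1n eqSS (inj_eq double_inj).
by rewrite coef0; case: eqP => // ij; rewrite -ij /= odd_double in oj.
Qed.

Lemma even_minv p : even_poly (minv p) = 0.
Proof.
elim/poly_lin_ind: p => [a p q IHp IHq|n].
  by rewrite !linearP /= IHp IHq scaler0 addr0.
rewrite minvXn; elim/ltn_ind: n => n IH.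
rewrite minv_basisE linearB (linear_sum (@even_poly R)) /= even_polyXn /= odd_double /=.
rewrite big1 ?subr0 //.
by move=> i _; rewrite linearZ /= IH ?scaler0.
Qed.

(** [phiu j] and [phiv i] are to be the images of [('X^j, 0)] and [(0, 'X^i)], found by solving
    [ndiv (phi w) = phi (opN w)] with [minv]. For even [j], [opN] kills [('X^j, 0)], and ['X^j] is
    corrected to a vector killed by [ndiv]. In the odd case [h] is the image of [(H 'X^i, 0)] and
    the inner [minv] is [phiv i], inlined. *)
Definition phiu : nat -> P :=
  course 0 (fun j g => if odd j then
      let i := j./2 in let h := if odd i then g i./2 else 0 in
      minv (h - g i - minv (g i - h))
    else 'X^j - minv (ndiv 'X^j)).
Definition phiv (i : nat) : P := minv (phiu i - lext phiu (odd_poly 'X^i)).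

Lemma phiuE j : phiu j =
  if odd j then minv (lext phiu (odd_poly 'X^(j./2)) - phiu j./2 - phiv j./2)
  else 'X^j - minv (ndiv 'X^j).
Proof.
have lextH i : lext phiu (odd_poly 'X^i) = if odd i then phiu i./2 else 0.
  by rewrite odd_polyXn; case: odd; rewrite ?lextXn ?linear0.
rewrite {1}/phiu courseE => [|m g h gh]; first by rewrite /phiv lextH.
case: ifP => // om; have m0 : (m./2 < m)%N by have := odd_double_half m; rewrite om; lia.
have m1 : (m./2./2 < m)%N by have := odd_double_half m./2; lia.
by rewrite /= !gh.
Qed.

Definition phi w : P := lext phiu w.1 + lext phiv w.2.

Lemma phi_lin : linear phi.
Proof. by move=> a [p q] [p' q']; rewrite /phi /= !linearP /= scalerDr addrACA. Qed.
HB.instance Definition _ := GRing.isLinear.Build R (P * P)%type P *:%R phi phi_lin.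

Definition opS w : P * P := (- w.2, w.1).
Definition opN w : P * P :=
  (odd_poly (odd_poly w.1) - odd_poly w.1 + w.2 - odd_poly w.2, - odd_poly w.1).
Definition opT w : P * P :=
  (odd_poly (odd_poly w.1) - odd_poly w.1 + w.1 + w.2 - odd_poly w.2, w.2 - odd_poly w.1).
Definition opTV w : P * P :=
  (w.1 + odd_poly w.2 - w.2, odd_poly w.1 + odd_poly (odd_poly w.2) - odd_poly w.2 + w.2).

Lemma opTE w : opT w = w + opN w.
Proof. by case: w => p q; congr (_, _); rewrite /=; ring. Qed.

Lemma opN_is_linear : linear opN.
Proof.
move=> a [p q] [p' q']; rewrite /opN /= !linearP /=.
by congr (_, _); rewrite /= -!mul_polyC; ring.
Qed.
HB.instance Definition _ := GRing.isLinear.Build R (P * P)%type (P * P)%type *:%R opN opN_is_linear.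

Lemma odd_polyN p : odd_poly (- p) = - odd_poly p.
Proof. exact: linearN. Qed.

Definition odd_polyL := (@odd_polyD R, odd_polyN, @odd_polyZ R).

Lemma opS_lin : linear opS.
Proof. by move=> a [p q] [p' q']; congr (_, _); rewrite /= -?mul_polyC; ring. Qed.

Lemma opT_lin : linear opT.
Proof.
move=> a [p q] [p' q']; congr (_, _); rewrite /= !odd_polyL -!mul_polyC; ring.
Qed.

Lemma opTV_lin : linear opTV.
Proof.
move=> a [p q] [p' q']; congr (_, _); rewrite /= !odd_polyL -!mul_polyC; ring.
Qed.

Lemma opTK : cancel opT opTV.
Proof.
move=> [p q]; rewrite /opT /opTV /= !odd_polyL.
by congr (_, _); ring.
Qed.

Lemma opTVK : cancel opTV opT.
Proof.
move=> [p q]; rewrite /opT /opTV /= !odd_polyL.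
by congr (_, _); rewrite /=; ring.
Qed.

Lemma opS4 w : opS (opS (opS (opS w))) = w.
Proof. by case: w => p q; rewrite /opS /= !opprK. Qed.

(* Cayley-Hamilton: [opS \o opT] has trace and determinant 1. *)
Lemma opST2 w : opS (opT (opS (opT w))) = opS (opT w) - w.
Proof.
case: w => p q; rewrite /opT /opS /= !odd_polyL.
move: (odd_poly (odd_poly (odd_poly (odd_poly p)))) (odd_poly (odd_poly (odd_poly p)))
  (odd_poly (odd_poly p)) (odd_poly p) (odd_poly (odd_poly (odd_poly q)))
  (odd_poly (odd_poly q)) (odd_poly q) => p4 p3 p2 p1 q3 q2 q1.
by congr (_, _); rewrite /=; ring.
Qed.

Lemma opST3 w : opS (opT (opS (opT (opS (opT w))))) = opS (opS w).
Proof.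
by rewrite opST2 opST2 addrAC subrr add0r; case: w => p q; rewrite /opS /=.
Qed.

(** On basis vectors this is the equation that [phiu] or [phiv] was built to solve, recovered by
    [ndiv_minv]. *)
Lemma ndiv_phi w : ndiv (phi w) = phi (opN w).
Proof.
case: w => p q; rewrite /phi /opN /= linearD /=.
have -> : ndiv (lext phiu p) =
    lext phiu (odd_poly (odd_poly p) - odd_poly p) - lext phiv (odd_poly p).
  elim/poly_lin_ind: p => [a p p' IHp IHp'|j].
    rewrite !(lextL, odd_polyL) linearP /= IHp IHp' !lextL -!mul_polyC; ring.
  rewrite lextXn [odd_poly 'X^j]odd_polyXn phiuE; case: ifP => oj.
    by rewrite ndiv_minv !lextL !lextXn.
  by rewrite (linearB ndiv) /= ndiv_minv subrr !lextL !raddf0 !addr0.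
have -> : ndiv (lext phiv q) = lext phiu (q - odd_poly q).
  elim/poly_lin_ind: q => [a q q' IHq IHq'|j].
    by rewrite !(lextL, odd_polyL) linearP /= IHq IHq' !lextL -!mul_polyC; ring.
  by rewrite lextXn ndiv_minv linearB /= lextXn.
rewrite !lextL; ring.
Qed.

Lemma even_phi w : even_poly (phi w) = even_poly w.1.
Proof.
case: w => p q; rewrite /phi /= linearD /=.
have -> : even_poly (lext phiv q) = 0.
  elim/poly_lin_ind: q => [a q q' IHq IHq'|j]; last by rewrite lextXn even_minv.
  by rewrite !linearP /= IHq IHq' scaler0 addr0.
rewrite addr0; elim/poly_lin_ind: p => [a p p' IHp IHp'|j].
  by rewrite !linearP /= IHp IHp'.
rewrite lextXn phiuE; case: ifP => oj; first by rewrite even_minv even_polyXn oj.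
by rewrite linearB /= even_minv subr0.
Qed.

(** * A right inverse of N', the intertwiner psi, and bijectivity *)

Lemma size_odd_poly_pred p : (size (odd_poly p) <= (size p).-1)%N.
Proof.
have := size_odd_poly p; have := odd_double_half (size p).
by move: (size p) (size (odd_poly p)) => a b; lia.
Qed.

Definition double_index : P -> P := lext (fun i => 'X^(i.*2.+1)).
(** The geometric series for [(1 - H)^-1], finite because [H] lowers the size. *)
Definition geo p : P := \sum_(k < size p) iter k (@odd_poly R) p.
(** To solve [opN (u, v) = (p, q)], the second component asks for [H u = - q], which [double_index]
    solves. The first component then reads [(1 - H) v = p - (1 - H) q]. *)
Definition opM w : P * P := (- double_index w.2, geo w.1 - w.2).

Lemma odd_double_index p : odd_poly (double_index p) = p.
Proof.
rewrite /double_index; elim/poly_lin_ind: p => [a p q IHp IHq|j].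
  by rewrite !(lextL, odd_polyL) IHp IHq.
by rewrite lextXn odd_polyXn /= odd_double uphalf_double.
Qed.

Lemma even_double_index p : even_poly (double_index p) = 0.
Proof.
rewrite /double_index; elim/poly_lin_ind: p => [a p q IHp IHq|j].
  by rewrite !lextL even_polyD even_polyZ IHp IHq scaler0 addr0.
by rewrite lextXn even_polyXn /= odd_double.
Qed.

Lemma iter_odd_poly_size p : iter (size p) (@odd_poly R) p = 0.
Proof.
suff gen k q : (size q <= k)%N -> iter k (@odd_poly R) q = 0 by apply: gen.
elim: k q => [|k IH] q qk; first by apply/eqP; rewrite -size_poly_leq0.
rewrite iterSr IH // (leq_trans (size_odd_poly _)) //.
by have := odd_double_half (size q); lia.
Qed.

Lemma geoE p : geo p - odd_poly (geo p) = p.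
Proof.
suff E : geo p = p + odd_poly (geo p) by rewrite {1}E addrK.
rewrite /geo (linear_sum (@odd_poly R)) /=.
rewrite -(big_ord_recl (size p) (fun i : 'I_(size p).+1 => iter i (@odd_poly R) p)).
by rewrite big_ord_recr /= iter_odd_poly_size addr0.
Qed.

Lemma opNM w : opN (opM w) = w.
Proof.
case: w => p q; rewrite /opN /opM /= !odd_polyL odd_double_index.
rewrite opprK; congr (_, _); rewrite -[p in RHS]geoE; ring.
Qed.

(** [opM] solves [opN (psi p) = psi (ndiv p)]. For even [j] the vector [('X^j, 0)], which [opN]
    kills, supplies the coordinate that [opM] does not create. *)
Definition psi_basis : nat -> P * P :=
  course 0 (fun j g => opM (\sum_(i < j) (i.+1 %| j.+1)%:R *: g i)
    + (if odd j then 0 else ('X^j, 0))).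
Definition psi : P -> P * P := lext psi_basis.
HB.instance Definition _ := GRing.Linear.on psi.

Lemma psi_basisE j :
  psi_basis j = opM (psi (ndiv 'X^j)) + (if odd j then 0 else ('X^j, 0)).
Proof.
rewrite ndivXn /psi lext_poly {1}/psi_basis courseE // => m g h gh.
by congr (opM _ + _); apply: eq_bigr => i _; rewrite gh.
Qed.

Lemma psiXn j : psi 'X^j = psi_basis j.
Proof. exact: lextXn. Qed.

Lemma opN_psi p : opN (psi p) = psi (ndiv p).
Proof.
elim/poly_lin_ind: p => [a p p' IHp IHp'|j]; first by rewrite !linearP /= IHp IHp'.
rewrite psiXn psi_basisE linearD /= opNM; case: ifP => oj; first by rewrite linear0 addr0.
rewrite (_ : opN ('X^j, 0) = 0) ?addr0 // /opN /= odd_polyXn oj.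
by rewrite !raddf0 !addr0.
Qed.

Lemma even_psi p : even_poly (psi p).1 = even_poly p.
Proof.
elim/poly_lin_ind: p => [a p p' IHp IHp'|j]; first by rewrite !linearP /= IHp IHp'.
rewrite psiXn psi_basisE /= linearD linearN /= even_double_index oppr0 add0r even_polyXn.
by case: ifP => oj; rewrite /= ?linear0 // even_polyXn oj.
Qed.

(** The second component gives [H p = 0], which with the vanishing even part gives [p = 0]. The
    first then becomes [q = H q], and iterating [H] ends in 0. *)
Lemma opN_inj w : even_poly w.1 = 0 -> opN w = 0 -> w = 0.
Proof.
case: w => p q /= ep [e1 e2].
have op : odd_poly p = 0 by apply/eqP; rewrite -oppr_eq0 e2.
have p0 : p = 0 by rewrite -[p]poly_even_odd ep op !comp_poly0 mul0r addr0.
rewrite op linear0 subr0 add0r in e1.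
have qfix n : iter n (@odd_poly R) q = q.
  by elim: n => //= n ->; apply/esym/eqP; rewrite -subr_eq0 e1.
by rewrite p0 -[q](qfix (size q)) iter_odd_poly_size.
Qed.

(** [phi (psi p) - p] has no even part, and [ndiv] sends it to the same difference for [ndiv p],
    which is 0 by induction on the size; [ndiv_inj] concludes. *)
Lemma psiK : cancel psi phi.
Proof.
move=> p; have [k pk] := ubnP (size p); elim: k p pk => // k IH p pk.
apply/eqP; rewrite -subr_eq0; apply/eqP/ndiv_inj.
  by rewrite (linearB (@even_poly R)) /= even_phi even_psi subrr.
rewrite (linearB ndiv) /= ndiv_phi opN_psi; have [->|p0] := eqVneq p 0.
  by rewrite !linear0 addr0.
rewrite IH ?subrr // (leq_ltn_trans (size_ndiv p)) //.
by move: p0; rewrite -size_poly_gt0; lia.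
Qed.

Lemma phiK : cancel phi psi.
Proof.
(* [opN] moves [q] into the first component without lowering its size. Doubled sizes, with one more
   counted for the second component, give a bound that [opN] does lower. *)
suff gen k p q : ((size p).*2 <= k)%N -> ((size q).*2 <= k.-1)%N -> psi (phi (p, q)) = (p, q).
  by move=> [p q]; apply: (gen ((size p).*2 + (size q).*2.+1)%N); lia.
elim: k p q => [|k IH] p q pk qk.
  have /eqP -> : p == 0 by rewrite -size_poly_leq0; lia.
  have /eqP -> : q == 0 by rewrite -size_poly_leq0; lia.
  by rewrite !linear0.
apply/eqP; rewrite -subr_eq0; apply/eqP/opN_inj.
  by rewrite /= (linearB (@even_poly R)) /= even_psi even_phi subrr.
rewrite (linearB opN) /= opN_psi ndiv_phi {1}/opN /= IH ?subrr //.
  have m : (size (odd_poly (odd_poly p) - odd_poly p + q - odd_poly q)%R <=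
      maxn (size p).-1 (size q))%N.
    have Hp := size_odd_poly_pred p; have Hq := size_odd_poly_pred q.
    have HHp := leq_trans (size_odd_poly_pred (odd_poly p)) (leq_pred _).
    apply: size_polyD_leq; [apply: size_polyD_leq; [apply: size_polyD_leq|]|];
      rewrite ?size_polyN leq_max ?Hp ?leqnn ?orbT //.
      by rewrite (leq_trans HHp Hp).
    by rewrite (leq_trans Hq (leq_pred _)) orbT.
  by move: m pk qk; move: (size _) (size p) (size q) => a b c; lia.
rewrite size_polyN; have := size_odd_poly_pred p; move: pk.
by move: (size _) (size p) => a b; lia.
Qed.

Lemma psi_lin : linear psi.
Proof. exact: lext_is_linear. Qed.

Lemma psi0 : psi 0 = 0.
Proof. exact: linear0. Qed.

Lemma phi0 : phi 0 = 0.
Proof. exact: linear0. Qed.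
End Operators.

(** * The filtration of pairs by size and its standard quotients *)

Section Filtration.
Variable R : comNzRingType.
Implicit Types (p : {poly R}) (w : {poly R} * {poly R}).

Definition size_le2 n w := (size w.1 <= n)%N && (size w.2 <= n)%N.

Definition std_coord n w : 'cV[R]_2 :=
  \col_i if i == 0 then w.1`_n else w.2`_n.

Lemma map_mx2 (R' : nzRingType) (h : R' -> R) a b c d :
  map_mx h (mx2 a b c d) = mx2 (h a) (h b) (h c) (h d).
Proof. by rewrite [LHS]mx2P !mxE. Qed.

Lemma mx2_mul_std_coord a b c d n w :
  mx2 a b c d *m std_coord n w =
  std_coord n (a *: w.1 + b *: w.2, c *: w.1 + d *: w.2).
Proof.
apply/colP => i; rewrite !mxE !big_ord_recl big_ord0 !mxE /= addr0 !coefD !coefZ.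
by case: ifP.
Qed.

Lemma size_odd_le n p : (size p <= n.+1)%N -> (size (odd_poly p) <= n)%N.
Proof.
by move=> pn; rewrite (leq_trans (size_odd_poly_pred p)) // -subn1 leq_subLR add1n.
Qed.

Lemma opS_std n w : size_le2 n.+1 w ->
  size_le2 n.+1 (opS w) /\ std_coord n (opS w) = map_mx intr S2 *m std_coord n w.
Proof.
move=> /andP [w1 w2]; split; first by rewrite /size_le2 /= size_polyN w2.
rewrite map_mx2 mx2_mul_std_coord; congr std_coord.
by rewrite rmorphN !scale0r scaleN1r scale1r add0r addr0.
Qed.

(** [H] lowers sizes, so its terms vanish at the coefficient [n], where [opT] acts as its
    specialization at [x = 0]. *)
Lemma opT_std n w : size_le2 n.+1 w ->
  size_le2 n.+1 (opT w) /\ std_coord n (opT w) = map_mx intr T2 *m std_coord n w.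
Proof.
move=> /andP [w1 w2]; have h1 := size_odd_le w1; have h2 := size_odd_le w2.
have h3 := size_odd_le (leqW h1).
split.
  by apply/andP; split; rewrite /= ?size_polyD_leq ?size_polyN // leqW.
rewrite map_mx2 mx2_mul_std_coord; apply/colP => i; rewrite !mxE /=.
rewrite !(coefD, coefN, coefZ) !(nth_default 0 h1) !(nth_default 0 h2) !(nth_default 0 h3).
by case: ifP => _; ring.
Qed.

Lemma opTV_std n w : size_le2 n.+1 w ->
  size_le2 n.+1 (opTV w) /\ std_coord n (opTV w) = map_mx intr T2V *m std_coord n w.
Proof.
move=> /andP [w1 w2]; have h1 := size_odd_le w1; have h2 := size_odd_le w2.
have h3 := size_odd_le (leqW h2).
split.
  by apply/andP; split; rewrite /= ?size_polyD_leq ?size_polyN // leqW.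
rewrite map_mx2 mx2_mul_std_coord; apply/colP => i; rewrite !mxE /= rmorphN.
rewrite !(coefD, coefN, coefZ) !(nth_default 0 h1) !(nth_default 0 h2) !(nth_default 0 h3).
by case: ifP => _; ring.
Qed.

End Filtration.

(** * Integrality *)

Section Integrality.
Variable R : comNzRingType.
Implicit Types (x y : R) (p q : {poly R}) (w : {poly R} * {poly R}).

Definition intval x := exists z : int, x = z%:~R.

Lemma intval_nat (n : nat) : intval n%:R. Proof. by exists n%:Z. Qed.

Lemma intvalD x y : intval x -> intval y -> intval (x + y).
Proof. by move=> [m ->] [n ->]; exists (m + n); rewrite rmorphD. Qed.

Lemma intvalN x : intval x -> intval (- x).
Proof. by move=> [m ->]; exists (- m); rewrite rmorphN. Qed.

Lemma intvalM x y : intval x -> intval y -> intval (x * y).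
Proof. by move=> [m ->] [n ->]; exists (m * n); rewrite rmorphM. Qed.

Definition intpoly p := forall i, intval p`_i.

Lemma intpoly0 : intpoly 0.
Proof. by move=> i; rewrite coef0; exact: (intval_nat 0). Qed.

Lemma intpolyXn n : intpoly 'X^n.
Proof. by move=> i; rewrite coefXn; exact: intval_nat. Qed.

Lemma intpolyD p q : intpoly p -> intpoly q -> intpoly (p + q).
Proof. by move=> hp hq i; rewrite coefD; apply: intvalD. Qed.

Lemma intpolyN p : intpoly p -> intpoly (- p).
Proof. by move=> hp i; rewrite coefN; apply: intvalN. Qed.

Lemma intpolyB p q : intpoly p -> intpoly q -> intpoly (p - q).
Proof. by move=> hp /intpolyN; apply: intpolyD. Qed.

Lemma intpolyZ x p : intval x -> intpoly p -> intpoly (x *: p).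
Proof. by move=> hx hp i; rewrite coefZ; apply: intvalM. Qed.

Lemma intpoly_sum n (F : 'I_n -> {poly R}) :
  (forall i, intpoly (F i)) -> intpoly (\sum_i F i).
Proof. by move=> h; apply: big_ind => //; [exact: intpoly0|exact: intpolyD]. Qed.

Lemma intpoly_odd p : intpoly p -> intpoly (odd_poly p).
Proof. by move=> hp i; rewrite coef_odd_poly. Qed.

Lemma intpoly_lext (b : nat -> {poly R}) p :
  (forall j, intpoly (b j)) -> intpoly p -> intpoly (lext b p).
Proof. by move=> hb hp; apply: intpoly_sum => i; apply: intpolyZ. Qed.

Lemma intpoly_ndiv p : intpoly p -> intpoly (ndiv p).
Proof.
move=> hp; apply: intpoly_lext => // j i; rewrite coef_poly.
by case: ifP => _; [exact: intval_nat|exact: (intval_nat 0)].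
Qed.

Lemma intpoly_minv p : intpoly p -> intpoly (minv p).
Proof.
apply: intpoly_lext => n; elim/ltn_ind: n => n IH; rewrite minv_basisE.
apply: intpolyB; first exact: intpolyXn.
by apply: intpoly_sum => i; apply: intpolyZ; [exact: intval_nat|exact: IH].
Qed.

Lemma intpoly_phiv i : (forall j, (j <= i)%N -> intpoly (phiu R j)) -> intpoly (phiv R i).
Proof.
move=> h; apply/intpoly_minv/intpolyB; first exact: h.
rewrite odd_polyXn; case: ifP => _; last by rewrite linear0; exact: intpoly0.
by rewrite lextXn; apply: h; have := odd_double_half i; lia.
Qed.

Lemma intpoly_phiu j : intpoly (phiu R j).
Proof.
elim/ltn_ind: j => j IH; rewrite phiuE; case: ifP => oj.
  have {}IH i : (i <= j./2)%N -> intpoly (phiu R i).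
    by move=> ij; apply: IH; have := odd_double_half j; rewrite oj; lia.
  apply/intpoly_minv/intpolyB; last exact: intpoly_phiv.
  apply/intpolyB; last exact: IH.
  rewrite odd_polyXn; case: ifP => _; last by rewrite linear0; exact: intpoly0.
  by rewrite lextXn; apply: IH; have := odd_double_half j./2; lia.
by apply/intpolyB/intpoly_minv/intpoly_ndiv; exact: intpolyXn.
Qed.

Definition intpair w := intpoly w.1 /\ intpoly w.2.

Lemma intpoly_phi w : intpair w -> intpoly (phi w).
Proof.
move=> [h1 h2]; apply: intpolyD; apply: intpoly_lext => // j; first exact: intpoly_phiu.
by apply: intpoly_phiv => i _; exact: intpoly_phiu.
Qed.

Lemma intpair_opM w : intpair w -> intpair (opM w).
Proof.
move=> [h1 h2]; split; rewrite /opM /=.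
  by apply: intpolyN; apply: intpoly_lext => // j; exact: intpolyXn.
apply: intpolyB => //; apply: intpoly_sum => k.
by elim: (k : nat) => //= n; exact: intpoly_odd.
Qed.

Lemma intpair_psi p : intpoly p -> intpair (psi p).
Proof.
(* Integrality of [b j] is asked only for [j < n], so that [lextP] also serves inside the induction,
   where only earlier images are known. *)
have lextP (b : nat -> {poly R} * {poly R}) q n :
    (forall j, (j < n)%N -> intpair (b j)) -> (size q <= n)%N -> intpoly q -> intpair (lext b q).
  move=> hb qn hq; rewrite (lextE _ qn); apply: big_ind.
  - by split; exact: intpoly0.
  - by move=> w w' [? ?] [? ?]; split; apply: intpolyD.
  - by move=> i _; have [h1 h2] := hb i (ltn_ord i); split; apply: intpolyZ.
move=> hp; apply: (lextP _ _ (size p)) => // j _; elim/ltn_ind: j => j IH.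
have [h1 h2] : intpair (opM (psi (ndiv ('X^j : {poly R})))).
  apply: intpair_opM; apply: (lextP _ _ j) => //.
    by rewrite (leq_trans (size_ndiv _)) // size_polyXn.
  by apply: intpoly_ndiv; exact: intpolyXn.
rewrite psi_basisE; case: ifP => _; first by rewrite addr0.
by split; apply: intpolyD => //; [exact: intpolyXn|exact: intpoly0].
Qed.

Lemma intpair_opS w : intpair w -> intpair (opS w).
Proof. by move=> [h1 h2]; split=> //=; apply: intpolyN. Qed.

Lemma intpair_opT w : intpair w -> intpair (opT w).
Proof.
by move=> [h1 h2]; split=> /=; do ?[apply: intpolyD|apply: intpolyN|apply: intpoly_odd].
Qed.

Lemma intpair_opTV w : intpair w -> intpair (opTV w).
Proof.
by move=> [h1 h2]; split=> /=; do ?[apply: intpolyD|apply: intpolyN|apply: intpoly_odd].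
Qed.
End Integrality.

(** * Growth *)

Section DivisorSums.
Variable F : realFieldType.

Lemma sum_inv_sqr_le (n : nat) : \sum_(e < n) (e.+2%:R ^- 2) <= 1 - n.+1%:R^-1 :> F.
Proof.
elim: n => [|n IH]; first by rewrite big_ord0 invr1 subrr.
rewrite big_ord_recr /=; apply: le_trans (lerD IH (lexx _)) _.
have n0 : 0 < n.+1%:R :> F by rewrite ltr0n.
rewrite -[n.+2%:R]natr1; set x : F := n.+1%:R in n0 *.
(* Telescoping: [1/(x+1)^2] is [1/x - 1/(x+1)] minus the positive term [1/(x (x+1)^2)]. *)
have -> : 1 - x^-1 + (x + 1) ^- 2 = 1 - (x + 1)^-1 - (x^-1 * (x + 1) ^- 2).
  by field; rewrite ?gt_eqF //; lra.
by rewrite gerBl mulr_ge0 ?invr_ge0 ?exprn_ge0 //; lra.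
Qed.

Lemma sum_eq_le1 (m k : nat) : \sum_(i < m) ((i == k :> nat)%:R : F) <= 1.
Proof.
suff -> : \sum_(i < m) ((i == k :> nat)%:R : F) = (k < m)%:R by rewrite lern1; case: ltnP.
elim: m => [|m IH]; first by rewrite big_ord0.
rewrite big_ord_recr /= IH ltnS [in RHS]leq_eqVlt [m == k]eq_sym.
by case: eqP => [->|_]; rewrite ?ltnn ?addr0 ?add0r.
Qed.

(* Writing a divisor [d <= n/2] as [n/e] bounds the sum of squares by [n^2] times the sum
   of [1/e^2] over [e >= 2]. *)
Lemma divisor_sum_sqr (n m : nat) : (0 < n)%N ->
  (forall i, (i < m)%N -> (i.+1 %| n)%N -> (2 * i.+1 <= n)%N) ->
  \sum_(i < m) (i.+1 %| n)%:R * i.+1%:R ^+ 2 <= n%:R ^+ 2 :> F.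
Proof.
move=> n0 hm.
apply: (@le_trans _ _ (\sum_(i < m) \sum_(e < n)
    (i == (n %/ e.+2).-1 :> nat)%:R * (n%:R ^+ 2 * e.+2%:R ^- 2))).
  apply: ler_sum => i _; case dv : (i.+1 %| n)%N; last first.
    rewrite mul0r sumr_ge0 // => e _.
    by rewrite !mulr_ge0 ?ler0n ?exprn_ge0 ?invr_ge0 ?exprn_ge0 ?ler0n.
  have h2 := hm i (ltn_ord i) dv; have [e nE] := dvdnP dv.
  have e2 : (1 < e)%N by nia.
  have en : (e.-2 < n)%N by nia.
  rewrite (bigD1 (Ordinal en)) //= mul1r -[leLHS]addr0 lerD //; last first.
    rewrite sumr_ge0 // => e' _.
    by rewrite !mulr_ge0 ?ler0n ?exprn_ge0 ?invr_ge0 ?exprn_ge0 ?ler0n.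
  have -> : e.-2.+2 = e by lia.
  have -> : (n %/ e).-1 = i by rewrite nE mulKn //; lia.
  rewrite eqxx mul1r nE natrM exprMn mulrAC mulfV ?mul1r //.
  by rewrite expf_neq0 // pnatr_eq0; lia.
rewrite exchange_big /=.
apply: (@le_trans _ _ (\sum_(e < n) n%:R ^+ 2 * e.+2%:R ^- 2)).
  apply: ler_sum => e _; rewrite -mulr_suml ler_piMl ?sum_eq_le1 //.
  by rewrite !mulr_ge0 ?ler0n ?exprn_ge0 ?invr_ge0 ?exprn_ge0 ?ler0n.
rewrite -mulr_sumr ler_piMr ?exprn_ge0 ?ler0n //.
by rewrite (le_trans (sum_inv_sqr_le n)) // gerBl invr_ge0 ler0n.
Qed.

(** A divisor [d <= n/q] has [d^a <= (n/q)^a], and [divisor_sum_sqr] sums the remaining squares. The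
    gain [q^-a] is what makes the recursions below contract. *)
Lemma divisor_sum_le (n m a q : nat) : (1 < q)%N -> (0 < n)%N ->
  (forall i, (i < m)%N -> (i.+1 %| n)%N -> (q * i.+1 <= n)%N) ->
  \sum_(i < m) (i.+1 %| n)%:R * i.+1%:R ^+ (a + 2) <=
    (n%:R / q%:R) ^+ a * n%:R ^+ 2 :> F.
Proof.
move=> q1 n0 hm.
have q0 : 0 < q%:R :> F by rewrite ltr0n; lia.
apply: (@le_trans _ _ (\sum_(i < m) (n%:R / q%:R) ^+ a * ((i.+1 %| n)%:R * i.+1%:R ^+ 2))).
  apply: ler_sum => i _; case dv: (i.+1 %| n)%N; last by rewrite !mul0r mulr0.
  rewrite !mul1r exprD ler_wpM2r ?exprn_ge0 ?ler0n // lerXn2r ?nnegrE ?ler0n //.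
    by rewrite divr_ge0 ?ler0n // ltW.
  by rewrite ler_pdivlMr // -natrM ler_nat mulnC hm.
rewrite -mulr_sumr ler_wpM2l ?exprn_ge0 ?divr_ge0 ?ler0n //.
by apply: divisor_sum_sqr => // i im dv; have := hm i im dv; nia.
Qed.
End DivisorSums.

(** * Weighted norms and bounds for the operators *)

Local Notation normc := ComplexField.Normc.normc.
Local Notation P := {poly CC}.

Lemma normc_ge0 (x : CC) : 0 <= normc x.
Proof. by case: x => a b; rewrite /= sqrtr_ge0. Qed.

Lemma normc_nat (n : nat) : normc (n%:R : CC) = n%:R.
Proof.
rewrite -[RHS]mulr_natr mul1r; transitivity (normc (1 : CC) *+ n); first exact: normcMn.
by rewrite (_ : normc 1 = 1) //; exact: ComplexField.Normc.normc1.
Qed.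

Lemma normcD_le (x y : CC) : normc (x + y) <= normc x + normc y.
Proof. exact: le_normcD. Qed.

Lemma normc_opp (x : CC) : normc (- x) = normc x.
Proof. exact: normcN. Qed.

Lemma normc_nul : normc (0 : CC) = 0.
Proof. exact: ComplexField.Normc.normc0. Qed.

Definition wt (c j : nat) : RR := j.+1%:R ^+ c.

Lemma wt_ge1 c j : 1 <= wt c j.
Proof. by rewrite exprn_ege1 // ler1n. Qed.

Lemma wt_ge0 c j : 0 <= wt c j.
Proof. exact: le_trans ler01 (wt_ge1 c j). Qed.

Lemma wt_mono c c' j j' : (c <= c')%N -> (j <= j')%N -> wt c j <= wt c' j'.
Proof.
move=> cc jj; apply: (@le_trans _ _ (wt c j')).
  by rewrite lerXn2r ?nnegrE ?ler0n // ler_nat.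
by rewrite ler_weXn2l // ler1n.
Qed.

Lemma wt_odd c i : wt c i.*2.+1 = 2 ^+ c * wt c i.
Proof. by rewrite /wt -exprMn -natrM mul2n doubleS. Qed.

Definition wnorm (c : nat) (p : P) : RR := \sum_(i < size p) normc p`_i * wt c i.

Lemma wnormE c n (p : P) : (size p <= n)%N -> wnorm c p = \sum_(i < n) normc p`_i * wt c i.
Proof.
move=> pn; rewrite /wnorm (big_ord_widen n (fun i => normc p`_i * wt c i) pn) big_mkcond.
apply: eq_bigr => i _; case: ltnP => // /(nth_default 0) ->.
by rewrite normc_nul mul0r.
Qed.

Lemma wnorm_ge0 c p : 0 <= wnorm c p.
Proof. by apply: sumr_ge0 => i _; rewrite mulr_ge0 ?normc_ge0 ?wt_ge0. Qed.

Lemma wnorm0 c : wnorm c 0 = 0.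
Proof. by rewrite /wnorm size_poly0 big_ord0. Qed.

Lemma wnormZ c a p : wnorm c (a *: p) = normc a * wnorm c p.
Proof.
rewrite (wnormE c (size_scale_leq a p)) mulr_sumr; apply: eq_bigr => i _.
by rewrite coefZ ComplexField.Normc.normcM mulrA.
Qed.

Lemma wnormD c p q : wnorm c (p + q) <= wnorm c p + wnorm c q.
Proof.
rewrite !(@wnormE c (maxn (size p) (size q))) ?leq_maxl ?leq_maxr ?size_polyD //.
rewrite -big_split; apply: ler_sum => i _ /=.
by rewrite coefD -mulrDl ler_wpM2r ?wt_ge0 // normcD_le.
Qed.

Lemma wnormN c p : wnorm c (- p) = wnorm c p.
Proof.
rewrite /wnorm size_polyN; apply: eq_bigr => i _.
by rewrite coefN normc_opp.
Qed.

Lemma wnormB c p q : wnorm c (p - q) <= wnorm c p + wnorm c q.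
Proof. by rewrite -(wnormN c q) wnormD. Qed.

Lemma wnormXn c j : wnorm c 'X^j = wt c j.
Proof.
rewrite /wnorm size_polyXn big_ord_recr /= coefXn eqxx ComplexField.Normc.normc1 mul1r.
by rewrite big1 ?add0r // => i _; rewrite coefXn ltn_eqF // normc_nul mul0r.
Qed.

Lemma wnorm_sum c n (F : 'I_n -> P) : wnorm c (\sum_i F i) <= \sum_i wnorm c (F i).
Proof.
elim/big_ind2: _ => [|x x' y y' h h'|//]; first by rewrite wnorm0.
exact: le_trans (wnormD _ _ _) (lerD h h').
Qed.

Lemma wnorm_mono c c' p : (c <= c')%N -> wnorm c p <= wnorm c' p.
Proof.
by move=> cc; apply: ler_sum => i _; rewrite ler_wpM2l ?normc_ge0 // wt_mono.
Qed.

Lemma coef_le_wnorm c (p : P) i : normc p`_i * wt c i <= wnorm c p.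
Proof.
have [ip|pi] := ltnP i (size p); last by rewrite nth_default // normc_nul mul0r wnorm_ge0.
rewrite /wnorm (bigD1 (Ordinal ip)) //= lerDl sumr_ge0 // => k _.
by rewrite mulr_ge0 ?normc_ge0 ?wt_ge0.
Qed.

(** For a weighted l1 norm, a bound on the basis vectors is a bound on the whole linear map. *)
Lemma wnorm_lext c c' (K : RR) (b : nat -> P) p :
  (forall j, wnorm c (b j) <= K * wt c' j) -> wnorm c (lext b p) <= K * wnorm c' p.
Proof.
move=> hb; apply: le_trans (wnorm_sum _ _) _.
rewrite mulr_sumr; apply: ler_sum => i _.
by rewrite wnormZ mulrCA ler_wpM2l ?normc_ge0.
Qed.

Lemma wnorm_odd c (p : P) : (0 < c)%N -> wnorm c (odd_poly p) <= 2^-1 * wnorm c p.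
Proof.
move=> c0; have -> : odd_poly p = lext (fun j => odd_poly 'X^j) p.
  elim/poly_lin_ind: p => [a p q IHp IHq|j]; last by rewrite lextXn.
  by rewrite !(lextL, odd_polyL) IHp IHq.
apply: wnorm_lext => j; rewrite odd_polyXn; case: ifP => oj; last first.
  by rewrite wnorm0 mulr_ge0 ?invr_ge0 ?wt_ge0.
rewrite wnormXn; set i := j./2.
have -> : j = i.*2.+1 by rewrite -[LHS]odd_double_half oj.
rewrite wt_odd mulrA -[X in 2 ^+ X](prednK c0) exprS mulKf ?pnatr_eq0 //.
by rewrite ler_peMl ?wt_ge0 // exprn_ege1 // ler1n.
Qed.

Lemma wnorm_odd1 c (p : P) : (0 < c)%N -> wnorm c (odd_poly p) <= wnorm c p.
Proof.
by move=> /(wnorm_odd p) h; have := wnorm_ge0 c p; lra.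
Qed.

Lemma wnorm_ndiv c (p : P) : (2 <= c)%N -> wnorm c (ndiv p) <= wnorm c p.
Proof.
move=> c2; rewrite -[leRHS]mul1r; apply: wnorm_lext => j; rewrite mul1r.
rewrite (wnormE c (size_poly _ _)).
apply: (@le_trans _ _ (\sum_(i < j) (i.+1 %| j.+1)%:R * i.+1%:R ^+ (c - 2 + 2))).
  by apply: ler_sum => i _; rewrite coef_poly ltn_ord normc_nat subnK.
apply: le_trans (@divisor_sum_le RR j.+1 j (c - 2) 2 _ _ _) _ => //.
  by move=> i ij /dvdnP [[|[|k]] kE]; nia.
rewrite /wt -[in leRHS](subnK c2) exprD ler_wpM2r ?exprn_ge0 ?ler0n //.
rewrite lerXn2r ?nnegrE ?divr_ge0 ?ler0n // ler_pdivrMr ?ltr0n // ler_peMr ?ler0n //.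
by rewrite ler1n.
Qed.

(** The constant [K = 2^(c+1)] reproduces itself: in 1-based indices, the leading term of [minv e_n]
    has norm [2^c n^c], half of [K n^c]. The divisors of [2n] below [n] are at most [2n/3] and
    contribute at most the other half. *)
Lemma wnorm_minv c (p : P) : (8 <= c)%N -> wnorm c (minv p) <= 2 ^+ c.+1 * wnorm c p.
Proof.
move=> c8; apply: wnorm_lext => n; elim/ltn_ind: n => n IH; rewrite minv_basisE.
apply: le_trans (wnormB _ _ _) _; rewrite wnormXn wt_odd.
have step : wnorm c (\sum_(i < n) (i.+1 %| n.*2.+2)%:R *: minv_basis _ i) <=
    2 ^+ c.+1 * \sum_(i < n) (i.+1 %| n.*2.+2)%:R * i.+1%:R ^+ (c - 2 + 2).
  apply: le_trans (wnorm_sum _ _) _; rewrite mulr_sumr; apply: ler_sum => i _.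
  rewrite wnormZ normc_nat mulrCA ler_wpM2l ?ler0n //.
  by apply: le_trans (IH i (ltn_ord i)) _; rewrite /wt subnK //; lia.
have dsum : \sum_(i < n) (i.+1 %| n.*2.+2)%:R * i.+1%:R ^+ (c - 2 + 2) <=
    (n.*2.+2%:R / 3%:R) ^+ (c - 2) * n.*2.+2%:R ^+ 2 :> RR.
  apply: divisor_sum_le => // i ij /dvdnP [[|[|[|k]]] kE]; nia.
have half : (n.*2.+2%:R / 3%:R) ^+ (c - 2) * n.*2.+2%:R ^+ 2 <= 2^-1 * wt c n :> RR.
  rewrite -doubleS -mul2n natrM mulrAC exprMn [(2 * _) ^+ 2]exprMn.
  rewrite /wt -{3}(subnK (leq_trans _ c8 : (2 <= c)%N)) // exprD.
  set x := _ ^+ (c - 2); set y := _ ^+ (c - 2); set z := n.+1%:R ^+ 2.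
  have y0 : 0 <= y * z by rewrite mulr_ge0 ?exprn_ge0 ?ler0n.
  (* The hypothesis [8 <= c] enters through [(2/3)^6 <= 1/8]. *)
  have x8 : x <= 8^-1.
    rewrite /x (_ : c - 2 = 6 + (c - 8))%N; last by lia.
    rewrite exprD -[8^-1]mulr1 ler_pM ?exprn_ge0 //; try lra.
    by apply: exprn_ile1; lra.
  have -> : x * y * (2 ^+ 2 * z) = (4 * x) * (y * z) by ring.
  by rewrite ler_wpM2r //; lra.
apply: le_trans (lerD (lexx _) step) _.
apply: le_trans (lerD (lexx _) (ler_wpM2l _ (le_trans dsum half))) _; first by rewrite exprn_ge0.
by rewrite exprS; lra.
Qed.

Lemma wnorm_lext_phiu c (B : RR) a i :
  (forall k, (k <= i)%N -> wnorm c (phiu _ k) <= B * wt a k) ->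
  wnorm c (lext (phiu _) (odd_poly 'X^i)) <= B * wt a i.
Proof.
move=> hB; have B0 : 0 <= B * wt a i by apply: le_trans (hB i _) => //; exact: wnorm_ge0.
rewrite odd_polyXn; case: ifP => _; last by rewrite linear0 wnorm0.
have i2 : (i./2 <= i)%N by have := odd_double_half i; lia.
rewrite lextXn (le_trans (hB _ i2)) // ler_wpM2l ?wt_mono //.
by move: B0; rewrite pmulr_lge0 // (lt_le_trans ltr01) ?wt_ge1.
Qed.

Lemma wnorm_phiv c (B : RR) a i : (8 <= c)%N ->
  (forall k, (k <= i)%N -> wnorm c (phiu _ k) <= B * wt a k) ->
  wnorm c (phiv _ i) <= 2 ^+ c.+1 * (B + B) * wt a i.
Proof.
move=> c8 hB; apply: le_trans (wnorm_minv _ c8) _.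
rewrite -mulrA ler_wpM2l ?exprn_ge0 // (le_trans (wnormB _ _ _)) // mulrDl.
by rewrite lerD ?hB // wnorm_lext_phiu.
Qed.

Lemma wnorm_phiu c j : (8 <= c)%N ->
  wnorm c (phiu _ j) <= (1 + 2 ^+ c.+1) * wt (2 * c + 4) j.
Proof.
(* Going from [i] to [j = 2i+1], two nested [minv] cost the factor [2 K (1 + K)], while the weight
   gains [2^a]. The choice of [a] makes [2^a = 4 K^2], which is enough since [K >= 1]. *)
move=> c8; set K : RR := 2 ^+ c.+1; set a := (2 * c + 4)%N; set B := 1 + K.
have K1 : 1 <= K by rewrite exprn_ege1 // ler1n.
elim/ltn_ind: j => j IH; rewrite phiuE; case: ifP => oj; last first.
  have cX : wnorm c ('X^j : P) <= wt a j by rewrite wnormXn wt_mono // /a; lia.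
  apply: le_trans (wnormB _ _ _) _; rewrite mulrDl mul1r lerD //.
  apply: le_trans (wnorm_minv _ c8) _; rewrite ler_wpM2l ?exprn_ge0 //.
  by apply: le_trans (wnorm_ndiv _ _) cX; lia.
have jE : j = j./2.*2.+1 by rewrite -[LHS]odd_double_half oj.
set i := j./2 in jE *.
have {}IH k : (k <= i)%N -> wnorm c (phiu _ k) <= B * wt a k.
  by move=> ki; apply: IH; lia.
have h1 := wnorm_lext_phiu IH; have h2 := IH i (leqnn i); have h3 := wnorm_phiv c8 IH.
apply: le_trans (wnorm_minv _ c8) _; rewrite -/K.
apply: (@le_trans _ _ (K * ((B + B + K * (B + B)) * wt a i))).
  rewrite ler_wpM2l ?exprn_ge0 // (le_trans (wnormB _ _ _)) //.
  rewrite mulrDl; apply: lerD; last exact: h3.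
  by rewrite mulrDl; apply: le_trans (wnormB _ _ _) _; exact: lerD.
rewrite jE wt_odd !mulrA ler_wpM2r ?wt_ge0 //.
have -> : 2 ^+ a = 4 * (K * K) :> RR.
  by rewrite /K -exprD (_ : 4 = 2 ^+ 2) -?exprD; [congr (_ ^+ _); rewrite /a; lia|ring].
have -> : K * (B + B + K * (B + B)) = B * (2 * K * (1 + K)) by ring.
by rewrite ler_wpM2l ?addr_ge0 //; nra.
Qed.

Definition wnorm2 c (w : P * P) : RR := wnorm c w.1 + wnorm c w.2.

Lemma wnorm2D c v w : wnorm2 c (v + w) <= wnorm2 c v + wnorm2 c w.
Proof. by rewrite /wnorm2 addrACA; apply: lerD; exact: wnormD. Qed.

Lemma wnorm2Z c a w : wnorm2 c (a *: w) = normc a * wnorm2 c w.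
Proof. by rewrite mulrDr; congr (_ + _); exact: wnormZ. Qed.

Lemma wnorm2_sum c n (b : 'I_n -> P * P) : wnorm2 c (\sum_i b i) <= \sum_i wnorm2 c (b i).
Proof.
elim/big_ind2: _ => [|x x' y y' h h'|//]; first by rewrite /wnorm2 !wnorm0 addr0.
exact: le_trans (wnorm2D _ _ _) (lerD h h').
Qed.

Lemma wnorm_phi c : (8 <= c)%N ->
  exists K a, 0 <= K /\ forall w, wnorm c (phi w) <= K * wnorm2 a w.
Proof.
move=> c8; set B : RR := 1 + 2 ^+ c.+1; set K := 2 ^+ c.+1 * (B + B).
have B0 : 0 <= B by rewrite addr_ge0 ?exprn_ge0.
have K0 : 0 <= K by apply: mulr_ge0; [exact: exprn_ge0|exact: addr_ge0].
exists (B + K), (2 * c + 4)%N; split=> [|[p q]]; first exact: addr_ge0.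
apply: le_trans (wnormD _ _ _) _; rewrite mulrDr; apply: lerD.
  apply: (@le_trans _ _ (B * wnorm (2 * c + 4) p)).
    by apply: wnorm_lext => j; exact: wnorm_phiu.
  by rewrite ler_wpM2r ?wnorm_ge0 ?lerDl.
apply: (@le_trans _ _ (K * wnorm (2 * c + 4) q)).
  by apply: wnorm_lext => j; apply: wnorm_phiv => // k _; exact: wnorm_phiu.
by rewrite ler_wpM2r ?wnorm_ge0 ?lerDr.
Qed.

Lemma wnorm_geo c (p : P) : (0 < c)%N -> wnorm c (geo p) <= 2 * wnorm c p.
Proof.
move=> c0; apply: le_trans (wnorm_sum _ _) _.
have it k : wnorm c (iter k (@odd_poly _) p) <= 2^-1 ^+ k * wnorm c p.
  elim: k => [|k IH]; first by rewrite mul1r.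
  rewrite iterS (le_trans (wnorm_odd _ c0)) // exprS -mulrA ler_wpM2l ?invr_ge0 //.
apply: le_trans (ler_sum _ (fun (k : 'I_(size p)) _ => it k)) _.
rewrite -mulr_suml ler_wpM2r ?wnorm_ge0 //.
suff -> n : \sum_(k < n) 2^-1 ^+ k = 2 - 2 * 2^-1 ^+ n :> RR.
  by rewrite gerBl mulr_ge0 // exprn_ge0 // invr_ge0.
elim: n => [|n IH]; first by rewrite big_ord0 expr0; ring.
by rewrite big_ord_recr /= IH exprS; field.
Qed.

Lemma wnorm2_opM c w : (0 < c)%N -> wnorm2 c (opM w) <= 2 ^+ c.+2 * wnorm2 c w.
Proof.
move=> c0; case: w => p q; rewrite /wnorm2 /opM /= wnormN.
have h1 : wnorm c (double_index q) <= 2 ^+ c * wnorm c q.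
  by apply: wnorm_lext => j; rewrite wnormXn wt_odd.
have h2 := wnorm_geo p c0; have h3 := wnormB c (geo p) q.
have E : 1 <= 2 ^+ c :> RR by rewrite exprn_ege1 // ler1n.
have := wnorm_ge0 c p; have := wnorm_ge0 c q; rewrite !exprS.
move: (2 ^+ c : RR) E h1 => E E1 h1 q0 p0; nra.
Qed.

(** Proper divisors are at most [n/2], so their sum gains [2^-(c+3)]. This cancels the factor
    [2^(c+2)] of [opM] and the 2 of the induction hypothesis; two further powers pay for the sum of
    squares. *)
Lemma wnorm_psi c p : (1 < c)%N -> wnorm2 c (psi p) <= 2 * wnorm (c + 5) p.
Proof.
move=> c1; pose a := (c + 5)%N.
suff hb j : wnorm2 c (psi_basis _ j) <= 2 * wt a j.
  apply: le_trans (wnorm2_sum _ _) _; rewrite mulr_sumr; apply: ler_sum => i _.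
  by rewrite wnorm2Z mulrCA ler_wpM2l ?normc_ge0.
elim/ltn_ind: j => j IH; rewrite psi_basisE (le_trans (wnorm2D _ _ _)) //.
rewrite (_ : 2 = 1 + 1 :> RR) // mulrDl mul1r lerD //; last first.
  case: ifP => _; first by rewrite /wnorm2 !wnorm0 addr0 wt_ge0.
  by rewrite /wnorm2 /= wnorm0 addr0 wnormXn wt_mono // leq_addr.
apply: le_trans (wnorm2_opM _ _) _; first exact: ltnW.
rewrite ndivXn /psi lext_poly.
apply: (@le_trans _ _ (2 ^+ c.+2 * (2 * \sum_(i < j) (i.+1 %| j.+1)%:R * i.+1%:R ^+ (c + 3 + 2)))).
  rewrite ler_wpM2l ?exprn_ge0 // (le_trans (wnorm2_sum _ _)) // mulr_sumr.
  apply: ler_sum => i _; rewrite wnorm2Z normc_nat mulrCA ler_wpM2l ?ler0n //.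
  by apply: le_trans (IH i (ltn_ord i)) _; rewrite /wt /a -addnA.
have := @divisor_sum_le RR j.+1 j (c + 3) 2 isT isT.
set s := \sum_(i < j) _ => hs.
have {}hs : s <= (j.+1%:R / 2%:R) ^+ (c + 3) * j.+1%:R ^+ 2.
  by apply: hs => i ij /dvdnP [[|[|k]] kE]; nia.
rewrite mulrA -exprSr; apply: le_trans (ler_wpM2l _ hs) _; first by rewrite exprn_ge0.
rewrite exprMn exprVn /wt /a (_ : c + 5 = c + 3 + 2)%N; last by rewrite -addnA.
rewrite (_ : c.+3 = c + 3)%N; last by rewrite addn3.
rewrite [in leRHS]exprD; have : 2 ^+ (c + 3) != 0 :> RR by rewrite expf_neq0 // pnatr_eq0.
move: (2 ^+ (c + 3) : RR) (j.+1%:R ^+ (c + 3) : RR) (j.+1%:R ^+ 2 : RR) => x y z x0.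
by rewrite (_ : x * _ = y * z) //; field.
Qed.

(** The constant 5, shared by the three generators, is the number of terms in the second argument of
    [opTV]. *)
Lemma wnorm2_opS c w : wnorm2 c (opS w) <= 5 * wnorm2 c w.
Proof.
case: w => p q; rewrite /wnorm2 /= wnormN.
by have := wnorm_ge0 c p; have := wnorm_ge0 c q; lra.
Qed.

Lemma wnorm2_opT c w : (0 < c)%N -> wnorm2 c (opT w) <= 5 * wnorm2 c w.
Proof.
move=> c0; case: w => p q; rewrite /wnorm2 /=.
have Hp := wnorm_odd1 p c0; have Hq := wnorm_odd1 q c0.
have HHp := wnorm_odd1 (odd_poly p) c0.
have := wnorm_ge0 c p; have := wnorm_ge0 c q.
have := wnormB c q (odd_poly p).
have := wnormB c (odd_poly (odd_poly p) - odd_poly p + p + q) (odd_poly q).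
have := wnormD c (odd_poly (odd_poly p) - odd_poly p + p) q.
have := wnormD c (odd_poly (odd_poly p) - odd_poly p) p.
have := wnormB c (odd_poly (odd_poly p)) (odd_poly p).
lra.
Qed.

Lemma wnorm2_opTV c w : (0 < c)%N -> wnorm2 c (opTV w) <= 5 * wnorm2 c w.
Proof.
move=> c0; case: w => p q; rewrite /wnorm2 /=.
have Hp := wnorm_odd1 p c0; have Hq := wnorm_odd1 q c0.
have HHq := wnorm_odd1 (odd_poly q) c0.
have := wnorm_ge0 c p; have := wnorm_ge0 c q.
have := wnormB c (p + odd_poly q) q.
have := wnormD c p (odd_poly q).
have := wnormD c (odd_poly p + odd_poly (odd_poly q) - odd_poly q) q.
have := wnormB c (odd_poly p + odd_poly (odd_poly q)) (odd_poly q).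
have := wnormD c (odd_poly p) (odd_poly (odd_poly q)).
lra.
Qed.

(** * The representation *)

Lemma deformed_action : exists f : 'M[int]_2 -> P * P -> P * P,
  [/\ forall w, f 1%:M w = w,
      forall w, f T2 w = opT w,
      forall X Y w, \det X = 1 -> \det Y = 1 -> f (X *m Y) w = f X (f Y w)
    & forall Y, \det Y = 1 ->
      [/\ linear (f Y),
          forall w, intpair w -> intpair (f Y w),
          forall n w, size_le2 n.+1 w ->
            size_le2 n.+1 (f Y w) /\ std_coord n (f Y w) = map_mx intr Y *m std_coord n w
        & forall c, (0 < c)%N ->
            exists2 K : RR, 0 <= K & forall w, wnorm2 c (f Y w) <= K * wnorm2 c w]].
Proof.
have [f [f1 fS fT fTV]] := SL2Z_action (@opTK CC) (@opTVK CC) (@opS4 CC) (@opST3 CC).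
exists f; split=> //.
- by move=> w; rewrite -[T2]mulmx1 fT ?det1 // f1.
- move=> X Y w dX dY; move: X dX w.
  apply: SL2Z_ind => [w|X dX IH w|X dX IH w|X dX IH w].
  + by rewrite mul1mx f1.
  + by rewrite -mulmxA !fS ?IH // det_mulmx dX dY mulr1.
  + by rewrite -mulmxA !fT ?IH // det_mulmx dX dY mulr1.
  + by rewrite -mulmxA !fTV ?IH // det_mulmx dX dY mulr1.
(* These properties are stable under composition, so [SL2Z_ind] reduces them to the generators. *)
pose good (g : P * P -> P * P) Y := [/\ linear g,
    forall w, intpair w -> intpair (g w),
    forall n w, size_le2 n.+1 w ->
      size_le2 n.+1 (g w) /\ std_coord n (g w) = map_mx intr Y *m std_coord n w
  & forall c, (0 < c)%N -> exists2 K : RR, 0 <= K & forall w, wnorm2 c (g w) <= K * wnorm2 c w].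
have comp (g h k : P * P -> P * P) X Y :
    good g X -> good h Y -> (forall w, k w = g (h w)) -> good k (X *m Y).
  move=> [g1 g2 g3 g4] [h1 h2 h3 h4] kE; split.
  - by move=> a v w; rewrite !kE h1 g1.
  - by move=> w /h2/g2; rewrite kE.
  - move=> n w /h3 [s1 e1]; have [s2 e2] := g3 _ _ s1.
    by rewrite kE map_mxM -mulmxA -e1 -e2.
  - move=> c c0; have [K K0 HK] := g4 c c0; have [L L0 HL] := h4 c c0.
    exists (K * L) => [|w]; first exact: mulr_ge0.
    by rewrite kE -mulrA (le_trans (HK _)) // ler_wpM2l.
have goodS : good (@opS CC) S2.
  split; [exact: opS_lin|exact: intpair_opS|exact: opS_std|].
  by move=> c c0; exists 5 => // w; exact: wnorm2_opS.
have goodT : good (@opT CC) T2.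
  split; [exact: opT_lin|exact: intpair_opT|exact: opT_std|].
  by move=> c c0; exists 5 => // w; exact: wnorm2_opT.
have goodTV : good (@opTV CC) T2V.
  split; [exact: opTV_lin|exact: intpair_opTV|exact: opTV_std|].
  by move=> c c0; exists 5 => // w; exact: wnorm2_opTV.
suff: forall Y, \det Y = 1 -> good (f Y) Y by [].
apply: SL2Z_ind => [|Y dY IH|Y dY IH|Y dY IH].
- split=> [a v w|w|n w|c c0]; rewrite ?f1 //; last by exists 1 => // w; rewrite f1 mul1r.
  by rewrite map_mx1 mul1mx.
- by apply: comp goodS IH _ => w; exact: fS.
- by apply: comp goodT IH _ => w; exact: fT.
- by apply: comp goodTV IH _ => w; exact: fTV.
Qed.

(** * Polynomial operators as infinite matrices *)

Definition coefs (p : P) : vec := fun k => p`_k.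

Lemma coefs_inj : injective coefs.
Proof. by move=> p q pq; apply/polyP => i; rewrite -/(coefs p i) pq. Qed.

Lemma finsupp_coefs (v : vec) : finsupp v <-> exists p, v = coefs p.
Proof.
split=> [[n vn]|[p ->]].
  exists (\poly_(i < n) v i); apply/funext => i; rewrite /coefs coef_poly.
  by case: ltnP => // /vn.
by exists (size p) => k; exact: nth_default.
Qed.

(** The quotient maps of the filtration take arbitrary vectors, so the inverse of [coefs] is
    extended by 0 to infinite supports. *)
Definition vec_poly (v : vec) : P :=
  if pselect (exists p, v = coefs p) is left h then projT1 (cid h) else 0.

Lemma coefsK : cancel coefs vec_poly.
Proof.
move=> p; rewrite /vec_poly; case: pselect => [h|[]]; last by exists p.
by apply: coefs_inj; rewrite -(projT2 (cid h)).
Qed.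

Definition op_mx (g : P -> P) : infmx := fun i j => (g 'X^j)`_i.

Lemma act_op_mx (g : P -> P) (p : P) w : linear g ->
  act_eq (op_mx g) (coefs p) w <-> w = coefs (g p).
Proof.
move=> glin; have E n i : (size p <= n)%N ->
    (g p)`_i = \sum_(k < n) op_mx g i k * p`_k.
  move=> pn; rewrite (linear_lextE glin pn) coef_sum.
  by apply: eq_bigr => k _; rewrite coefZ mulrC.
split=> [h|-> i n pn]; last by apply: E; apply/leq_sizeP.
by apply/funext => i; rewrite (h i (size p)) -?E // => k; exact: nth_default.
Qed.

Lemma mxmul_op_mx (g h k : P -> P) : linear g ->
  (forall p, k p = g (h p)) -> mxmul_eq (op_mx g) (op_mx h) (op_mx k).
Proof.
move=> glin kE i j n hn; rewrite /op_mx kE (linear_lextE (n := n) glin); last exact/leq_sizeP.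
by rewrite coef_sum; apply: eq_bigr => l _; rewrite coefZ mulrC.
Qed.

Lemma colfin_op_mx (g : P -> P) : colfin (op_mx g).
Proof. by move=> j; exists (size (g 'X^j)) => i; exact: nth_default. Qed.

Lemma op_mx_id (g : P -> P) : (forall p, g p = p) -> op_mx g = idmx.
Proof.
move=> gE; apply/funext => i; apply/funext => j.
by rewrite /op_mx gE coefXn /idmx; case: eqP.
Qed.

Lemma op_mx_divisor (g : P -> P) :
  (forall p, g p = divisor_op p) -> op_mx g = divisor_mx.
Proof.
move=> gE; apply/funext => i; apply/funext => j.
rewrite /op_mx gE /divisor_op lextXn coef_poly /divisor_mx ltnS.
case: leqP => ij; first by case: (_ %| _)%N.
by rewrite gtnNdvd.
Qed.

Lemma normc_intr_ge1 (z : int) : z%:~R != 0 :> CC -> 1 <= normc (z%:~R : CC).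
Proof.
case: z => n; first by rewrite normc_nat pnatr_eq0 ler1n lt0n.
by rewrite NegzE rmorphN normc_opp normc_nat ler1n.
Qed.

(** A nonzero integral entry has absolute value at least 1. The bound on an entry times the weight
    of its row therefore bounds the row index as well. *)
Lemma DR0_op_mx (g : P -> P) (K : RR) (a : nat) : 0 <= K ->
  (forall p, intpoly p -> intpoly (g p)) ->
  (forall p, wnorm 8 (g p) <= K * wnorm a p) -> DR0 (op_mx g).
Proof.
move=> K0 gint gK; split; first exact: colfin_op_mx.
(* The shifts make both constants positive even if [K] or [a] is 0. *)
exists (K + 1), a.+1%:R; do 2! [split; first by rewrite ?ltr0n // ltr_wpDl].
move=> i j; rewrite powR_mulrn ?ler0n //.
have B : normc (op_mx g i j) * wt 8 i <= (K + 1) * j.+1%:R ^+ a.+1.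
  apply: le_trans (coef_le_wnorm _ _ _) _; apply: le_trans (gK _) _; rewrite wnormXn.
  apply: ler_pM; rewrite ?wt_ge0 ?lerDl //; exact: wt_mono.
split; last first.
  by apply: le_trans B; rewrite ler_peMr ?normc_ge0 ?wt_ge1.
move=> iK; have [z zE] := gint _ (intpolyXn CC j) i.
apply/eqP/negPn/negP => nz; move: iK; apply/negP; rewrite -leNgt.
apply: le_trans B; apply: (@le_trans _ _ (wt 8 i)).
  by rewrite /wt exprS ler_peMr ?ler0n // exprn_ege1 // ler1n.
by rewrite ler_peMl ?wt_ge0 // /op_mx zE normc_intr_ge1 // -zE.
Qed.

Theorem theorem3p1 :
  exists rho : 'M[int]_2 -> infmx,
    (* rho is a group homomorphism SL(2,Z) -> A^x *)
    (forall Y, inSL2Z Y -> is_unit_mx (rho Y)) /\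
    rho 1%:M = idmx /\
    (forall X Y, inSL2Z X -> inSL2Z Y -> mxmul_eq (rho X) (rho Y) (rho (X *m Y))) /\
    (* (a) ascending exhaustive filtration by submodules with standard quotients *)
    (exists Efil : nat -> vec -> Prop,
        (forall v, Efil 0%N v <-> v = (fun _ => 0)) /\
        (forall i, submoduleE rho (Efil i)) /\
        (forall i v, Efil i v -> Efil i.+1 v) /\
        (forall v, finsupp v -> exists i, Efil i v) /\
        (forall i, quot_iso_std rho (Efil i.+1) (Efil i))) /\
    (* (b) *)
    rho Tmx = divisor_mx /\
    (* (c) *)
    (forall Y, inSL2Z Y -> forall i j, exists z : int, rho Y i j = z%:~R) /\
    (* (d) *)
    (forall Y, inSL2Z Y -> DR0 (rho Y)).
Proof.
have [f [f1 fT fM f_good]] := deformed_action.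
pose g Y p := phi (f Y (psi p)).
have g_lin Y : inSL2Z Y -> linear (g Y).
  move=> /f_good [flin _ _ _] a p q.
  by rewrite /g psi_lin flin phi_lin.
have gM X Y p : inSL2Z X -> inSL2Z Y -> g (X *m Y) p = g X (g Y p).
  by move=> dX dY; rewrite /g fM // phiK.
have g_id p : g 1%:M p = p by rewrite /g f1 psiK.
have g_int Y p : inSL2Z Y -> intpoly p -> intpoly (g Y p).
  by move=> /f_good [_ fint _ _] hp; apply/intpoly_phi/fint/intpair_psi.
have mulE X Y : inSL2Z X -> inSL2Z Y ->
    mxmul_eq (op_mx (g X)) (op_mx (g Y)) (op_mx (g (X *m Y))).
  by move=> dX dY; apply: mxmul_op_mx => [|p]; [exact: g_lin|exact: gM].
have id_mx : op_mx (g 1%:M) = idmx by exact: op_mx_id.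
exists (fun Y => op_mx (g Y)); split; last split; last split; last split; last split; last split.
- move=> Y dY; split; first exact: colfin_op_mx.
  have uY : Y \in unitmx by rewrite unitmxE dY unitr1.
  have dV : inSL2Z (invmx Y) by rewrite /inSL2Z det_inv dY invr1.
  exists (op_mx (g (invmx Y))); split; first exact: colfin_op_mx.
  have h1 := mulE _ _ dY dV; rewrite mulmxV // id_mx in h1.
  by have h2 := mulE _ _ dV dY; rewrite mulVmx // id_mx in h2.
- exact: id_mx.
- exact: mulE.
(* The filtration of pairs by size, pulled back along [psi]; the quotient maps read the coefficients
   of ['X^n] in both components. *)
- pose S n (v : vec) := exists2 p, v = coefs p & size_le2 n (psi p).
  have S_lin n a v w : S n v -> S n w -> S n (fun k => a * v k + w k).
    move=> [p -> /andP [p1 p2]] [q -> /andP [q1 q2]]; exists (a *: p + q).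
      by apply/funext => k; rewrite /coefs coefD coefZ.
    rewrite psi_lin /size_le2 /= !size_polyD_leq //.
      exact: leq_trans (size_scale_leq _ _) p2.
    exact: leq_trans (size_scale_leq _ _) p1.
  have S_act Y p w : inSL2Z Y -> act_eq (op_mx (g Y)) (coefs p) w ->
      w = coefs (g Y p) /\ psi (g Y p) = f Y (psi p).
    by move=> dY /(act_op_mx _ _ (g_lin Y dY)) ->; split=> //; rewrite /g phiK.
  have size_le2S n w : size_le2 n.+1 w -> std_coord n w = 0 -> size_le2 n w.
    move=> /andP [w1 w2] /colP wn; have := wn 0; have := wn 1; rewrite !mxE /= => z2 z1.
    apply/andP; split; apply/leq_sizeP => k; rewrite leq_eqVlt => /orP [/eqP <-|nk] //.
      exact: nth_default (leq_trans w1 nk).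
    exact: nth_default (leq_trans w2 nk).
  have S_sub n v : S n v -> S n.+1 v.
    by move=> [p pE /andP [p1 p2]]; exists p => //; rewrite /size_le2 !leqW.
  have S_le n Y w : inSL2Z Y -> size_le2 n w -> size_le2 n (f Y w).
    case: n => [|n] dY; last by move=> wn; have [_ _ /(_ n w wn) []] := f_good Y dY.
    rewrite /size_le2 !size_poly_leq0; case: w => p q /= /andP [/eqP -> /eqP ->].
    (* At [n = 0] the claim is [f Y 0 = 0], which linearity gives as [- f Y 0 + f Y 0]. *)
    have [flin _ _ _] := f_good Y dY.
    have := flin (- 1) 0 0; rewrite scaler0 addr0 scaleN1r addNr => -> /=.
    by rewrite eqxx.
  exists S; split; last split; last split; last split.
  + move=> v; split=> [[p ->]|->].
      rewrite /size_le2 !size_poly_leq0 => /andP [/eqP p1 /eqP p2].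
      apply/funext => k; rewrite -[p]psiK [psi p]surjective_pairing p1 p2.
      by rewrite phi0 /coefs coef0.
    exists 0; first by apply/funext => k; rewrite /coefs coef0.
    by rewrite psi0 /size_le2 size_poly0.
  + move=> n; split.
      split; first by move=> v [p -> _]; apply/finsupp_coefs; exists p.
      split=> [|a v w]; last exact: S_lin.
      exists 0; first by apply/funext => k; rewrite /coefs coef0.
      by rewrite psi0 /size_le2 /= size_poly0.
    move=> Y dY v w [p -> pn] /(S_act Y p w dY) [-> psiE].
    by exists (g Y p) => //; rewrite psiE; exact: S_le.
  + exact: S_sub.
  + move=> v /finsupp_coefs [p ->]; exists (maxn (size (psi p).1) (size (psi p).2)), p => //.
    by rewrite /size_le2 leq_maxl leq_maxr.
  + move=> n; exists (fun v => std_coord n (psi (vec_poly v))); split; last split; last split.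
    * move=> a v w [p -> _] [q -> _].
      have -> : (fun k => a * coefs p k + coefs q k) = coefs (a *: p + q).
        by apply/funext => k; rewrite /coefs coefD coefZ.
      rewrite !coefsK psi_lin; apply/colP => i; rewrite !mxE /= !coefD !coefZ.
      by case: ifP.
    * move=> x; pose w := (x 0 0 *: 'X^n : P, x 1 0 *: 'X^n : P).
      exists (coefs (phi w)); split.
        exists (phi w) => //; rewrite phiK /size_le2 /=.
        by rewrite !(leq_trans (size_scale_leq _ _)) ?size_polyXn.
      rewrite coefsK phiK; apply/colP => i; rewrite !mxE /= !coefZ coefXn eqxx !mulr1.
      by case: (unliftP 0 i) => [i'|] -> //=; rewrite ord1; congr (x _ _); apply: val_inj.
    * move=> v [p -> pn]; rewrite coefsK; split=> [pz|[q /coefs_inj <- /andP [p1 p2]]].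
        by exists p => //; exact: size_le2S.
      by apply/colP => i; rewrite !mxE !nth_default // if_same.
    * move=> Y dY v w [p -> pn] /(S_act Y p w dY) [-> psiE].
      by rewrite !coefsK psiE; have [_ _ /(_ n _ pn) [_ ->] _] := f_good Y dY.
- apply: op_mx_divisor => p.
  have -> : Tmx = T2.
    by apply/matrixP => i j; rewrite !mxE; case: i j => [[|[|i]] hi] [[|[|j]] hj].
  (* [phi (1 + opN) psi = 1 + ndiv], as [phi] intertwines [opN] with [ndiv]. *)
  by rewrite /g fT opTE linearD /= -ndiv_phi psiK divisor_opE.
- by move=> Y dY i j; exact: g_int (intpolyXn CC j) i.
- move=> Y dY; have [K [a [K0 HK]]] := wnorm_phi (leqnn 8).
  have [_ _ _ /(_ a.+2 isT) [L L0 HL]] := f_good Y dY.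
  (* [phi] asks for exponent [a], raised to [a.+2] to meet the conditions on [f] and [psi]; [psi]
     costs 5 more. *)
  apply: (@DR0_op_mx _ (K * (L * 2)) (a.+2 + 5)).
  + by rewrite !mulr_ge0.
  + by move=> p; exact: g_int.
  + move=> p; apply: le_trans (HK _) _; rewrite -!mulrA ler_wpM2l //.
    apply: (@le_trans _ _ (wnorm2 a.+2 (f Y (psi p)))).
      by rewrite lerD // wnorm_mono // ltnW.
    apply: le_trans (HL _) _; rewrite ler_wpM2l //; exact: wnorm_psi.
Qed.
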